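(* For any symplectic surface $(M,\omega)$ and any $\epsilon>0$, there exist a locally finite open cover $\mathcal{U}=\{U_i\}_{i\in I}$ of $M$ by discs, with a member $U_1\in\mathcal{U}$ that is confined and essential, and a positive collection $\mathcal{F}=\{f_i\}_{i\in I}\prec\mathcal{U}$ such that $$\int_{U_1}\sum_{i\in I}|\{f_i,f_1\}|\,\omega\;\le\;1+\epsilon .$$
   Context: A symplectic surface $(M,\omega)$ is a smooth 2-manifold $M$ with an area form $\omega$. The symplectic gradient $X_H$ of $H\in C^\infty(M)$ is defined by $-\mathrm{d}H=\omega(X_H,\cdot)$, and the Poisson bracket is $\{G,H\}:=-\omega(X_G,X_H)$. A positive collection on $M$ is a locally finite collection $\mathcal{F}=\{f_i\}_{i\in I}$ of smooth functions $f_i:M\to[0,\infty)$ with $\sum_{i\in I}f_i(x)\ge 1$ for all $x\in M$. It is subordinate to a locally finite open cover $\mathcal{U}=\{U_i\}_{i\in I}$, written $\mathcal{F}\prec\mathcal{U}$, if $\mathrm{supp}(f_i)=\overline{\{f_i\ne0\}}\subseteq U_i$ for each $i\in I$. A connected subset $X\subset M$ is confined (with respect to $\mathcal{U}$) if some connected component of $\partial\overline{X}$ is not contained in any single $U\in\mathcal{U}$. A disc $U\in\mathcal{U}$ is essential (to $\mathcal{U}$) if $\mathcal{U}\setminus\{U\}$ is not a cover of $M$. *)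

(* Defs.v *)
(* World: Mathematical Components + MathComp-Analysis. *)
From HB Require Import structures.
From mathcomp Require Import all_boot all_order all_algebra.
From mathcomp Require Import all_classical all_reals all_analysis.
From mathcomp Require Import ring.

Set Implicit Arguments.
Unset Strict Implicit.
Unset Printing Implicit Defensive.

Import Order.TTheory GRing.Theory Num.Theory.
Import numFieldNormedType.Exports.

Local Open Scope classical_set_scope.
Local Open Scope ring_scope.

Definition plane (R : realType) : normedModType R := (R * R)%type.

Definition plane_measure (R : realType) :=
  ((@lebesgue_measure R) \x (@lebesgue_measure R))%E.

Definition unit_disc (R : realType) : set (plane R) :=
  [set p | p.1 ^+ 2 + p.2 ^+ 2 < 1].

(* [Ck_on O k F]: F is of class C^k on O. This reads correctly for open O only:
   the derivatives 'D_v F are taken in the whole plane. *)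
Fixpoint Ck_on (R : realType) (V : normedModType R) (O : set (plane R))
    (k : nat) (F : plane R -> V) : Prop :=
  if k is k'.+1 then
    (forall p v, O p -> derivable F p v) /\ (forall v, Ck_on O k' ('D_v F))
  else {within O, continuous F}.

Definition smooth_on (R : realType) (V : normedModType R) (O : set (plane R))
    (F : plane R -> V) : Prop := forall k, Ck_on O k F.

(* A chart is a homeomorphism between an open subset of M and an open subset of
   the plane. Both maps are total functions whose values outside the domain
   (resp. codomain) are irrelevant. An empty domain is allowed. *)
Record chart (R : realType) (M : topologicalType) := Chart {
  chart_dom : set M ;
  chart_cod : set (plane R) ;
  chart_map : M -> plane R ;
  chart_inv : plane R -> M ;
  chart_dom_open : open chart_dom ;
  chart_cod_open : open chart_cod ;
  chart_map_cod : forall x, chart_dom x -> chart_cod (chart_map x) ;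
  chart_inv_dom : forall p, chart_cod p -> chart_dom (chart_inv p) ;
  chart_mapK : forall x, chart_dom x -> chart_inv (chart_map x) = x ;
  chart_invK : forall p, chart_cod p -> chart_map (chart_inv p) = p ;
  chart_map_continuous : {within chart_dom, continuous chart_map} ;
  chart_inv_continuous : {within chart_cod, continuous chart_inv} }.

Definition smooth_transition (R : realType) (M : topologicalType)
    (c d : chart R M) : Prop :=
  smooth_on (chart_map c @` (chart_dom c `&` chart_dom d))
            (chart_map d \o chart_inv c).

(* A smooth 2-manifold without boundary, presented by a countable smooth atlas.
   Second countability is equivalent to the existence of a countable atlas, and
   M is nonempty because [chart_inv] is a total function into M. *)
Record smooth_surface (R : realType) (M : topologicalType) := SmoothSurface {
  atlas : nat -> chart R M ;
  surface_hausdorff : hausdorff_space M ;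
  atlas_cover : forall x, exists n, chart_dom (atlas n) x ;
  atlas_smooth : forall m n, smooth_transition (atlas m) (atlas n) }.

(* c belongs to the maximal smooth atlas of S. *)
Definition smooth_chart (R : realType) (M : topologicalType)
    (S : smooth_surface R M) (c : chart R M) : Prop :=
  forall n, smooth_transition c (atlas S n) /\ smooth_transition (atlas S n) c.

Definition smooth_fun (R : realType) (M : topologicalType)
    (S : smooth_surface R M) (f : M -> R) : Prop :=
  forall n, smooth_on (chart_cod (atlas S n)) (f \o chart_inv (atlas S n)).

Lemma atlas_coverb (R : realType) (M : topologicalType)
    (S : smooth_surface R M) (x : M) :
  exists n, `[< chart_dom (atlas S n) x >].
Proof. by have [n xn] := atlas_cover S x; exists n; apply/asboolP. Qed.

(* The first chart of the atlas around x. The tangent space at x is identified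
   with the plane by means of this preferred chart: a tangent vector at x is the
   vector of its coordinates in [chart_at S x]. *)
Definition chart_index (R : realType) (M : topologicalType)
    (S : smooth_surface R M) (x : M) : nat := ex_minn (atlas_coverb S x).

Definition chart_at (R : realType) (M : topologicalType)
    (S : smooth_surface R M) (x : M) : chart R M := atlas S (chart_index S x).

(* The tangent vector at x with coordinates u in the chart c around x, expressed
   in the preferred chart at x. *)
Definition tangent_of_chart (R : realType) (M : topologicalType)
    (S : smooth_surface R M) (c : chart R M) (x : M) (u : plane R) : plane R :=
  'd (chart_map (chart_at S x) \o chart_inv c) (chart_map c x) u.

(* The differential of H at x, as a form on the tangent space at x. *)
Definition differential (R : realType) (M : topologicalType)
    (S : smooth_surface R M) (H : M -> R) (x : M) (v : plane R) : R :=
  'd (H \o chart_inv (chart_at S x)) (chart_map (chart_at S x) x) v.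

(* A nowhere vanishing smooth 2-form. *)
Record area_form (R : realType) (M : topologicalType)
    (S : smooth_surface R M) := AreaForm {
  form_at :> M -> plane R -> plane R -> R ;
  form_linear : forall x a u v w,
    form_at x (a *: u + v) w = a * form_at x u w + form_at x v w ;
  form_antisym : forall x u v, form_at x u v = - form_at x v u ;
  form_nonvanishing : forall x, exists u v, form_at x u v != 0 ;
  form_smooth : forall n u v,
    smooth_on (chart_cod (atlas S n)) (fun p =>
      let x := chart_inv (atlas S n) p in
      form_at x (tangent_of_chart S (atlas S n) x u)
                (tangent_of_chart S (atlas S n) x v)) }.

(* The vector field X_H with -dH = w(X_H, .), unique since w is nondegenerate. *)
Definition symplectic_gradient (R : realType) (M : topologicalType)
    (S : smooth_surface R M) (w : area_form S) (H : M -> R) (x : M) : plane R :=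
  xget 0 [set X | forall v, - differential S H x v = w x X v].

Lemma symplectic_gradientP (R : realType) (M : topologicalType)
    (S : smooth_surface R M) (w : area_form S) (H : M -> R) (x : M) (v : plane R) :
  - differential S H x v = w x (symplectic_gradient w H x) v.
Proof.
pose e1 : plane R := (1, 0); pose e2 : plane R := (0, 1).
have eE (a b : R) : (a, b) = a *: e1 + b *: e2 :> plane R.
  by congr pair; rewrite /= /GRing.scale/= ?(mulr0, mulr1, addr0, add0r).
have w0 (z : plane R) : w x 0 z = 0.
  have := form_linear w x 1 0 0 z; rewrite scale1r add0r mul1r => /eqP.
  by rewrite -subr_eq0 opprD addNKr oppr_eq0 => /eqP.
have w00 (u : plane R) : w x u u = 0.
  have /eqP := form_antisym w x u u.
  by rewrite -subr_eq0 opprK -mulr2n mulrn_eq0 => /eqP.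
have wD (a b : R) (y : plane R) : w x (a, b) y = a * w x e1 y + b * w x e2 y.
  by rewrite eE -[b *: e2]addr0 !form_linear w0 addr0.
have w1 (c d : R) : w x e1 (c, d) = d * w x e1 e2.
  rewrite form_antisym wD w00 mulr0 add0r.
  by rewrite (form_antisym w x e2 e1) mulrN opprK.
have w2 (c d : R) : w x e2 (c, d) = - (c * w x e1 e2).
  by rewrite form_antisym wD w00 mulr0 addr0.
have wE (a b c d : R) : w x (a, b) (c, d) = (a * d - b * c) * w x e1 e2.
  by rewrite wD w1 w2 mulrN !mulrA mulrBl.
have w_neq0 : w x e1 e2 != 0.
  have [[a b] [[c d]]] := form_nonvanishing w x.
  by rewrite wE mulf_eq0 negb_or => /andP[].
rewrite /symplectic_gradient; case: xgetP => [X _ //|noX]; exfalso.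
pose L : plane R -> R := differential S H x.
apply: (noX (- L e2 / w x e1 e2, L e1 / w x e1 e2)) => -[a b].
have -> : differential S H x (a, b) = a * L e1 + b * L e2.
  by rewrite /L /differential eE linearD !linearZ.
rewrite wE; move: (w x e1 e2) (L e1) (L e2) w_neq0 => r l1 l2 r_neq0.
by field.
Qed.

Definition poisson_bracket (R : realType) (M : topologicalType)
    (S : smooth_surface R M) (w : area_form S) (G H : M -> R) (x : M) : R :=
  - w x (symplectic_gradient w G x) (symplectic_gradient w H x).

(* The points whose preferred chart is the n-th one. These Borel sets form a
   partition of M. *)
Definition cell (R : realType) (M : topologicalType)
    (S : smooth_surface R M) (n : nat) : set M := [set x | chart_index S x = n].

(* The integral over A of g w for g >= 0, M being oriented by w. It is computed
   on each cell in the chart that covers it; there the preferred chart is the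
   chart itself, so |w(e1, e2)| is the density of w in that chart. *)
Definition integral_form (R : realType) (M : topologicalType)
    (S : smooth_surface R M) (w : area_form S) (A : set M) (g : M -> R) : \bar R :=
  (\sum_(0 <= n <oo)
    \int[@plane_measure R]_(p in chart_map (atlas S n) @` (A `&` cell S n))
      (g (chart_inv (atlas S n) p) *
        `|w (chart_inv (atlas S n) p) (1%R, 0%R) (0%R, 1%R)|)%:E)%E.

(* U is open and diffeomorphic to the open unit disc. *)
Definition disc (R : realType) (M : topologicalType)
    (S : smooth_surface R M) (U : set M) : Prop :=
  exists c : chart R M,
    [/\ smooth_chart S c, chart_dom c = U & chart_cod c = @unit_disc R].

Definition locally_finite_family (M : topologicalType) (I : Type)
    (U : I -> set M) : Prop :=
  forall x : M, exists2 N, nbhs x N & finite_set [set i | U i `&` N !=set0].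

Definition disc_cover (R : realType) (M : topologicalType)
    (S : smooth_surface R M) (I : Type) (U : I -> set M) : Prop :=
  [/\ forall i, disc S (U i), locally_finite_family U &
      \bigcup_i U i = setT].

Definition frontier (M : topologicalType) (A : set M) : set M :=
  closure A `\` interior A.

Definition confined (M : topologicalType) (I : Type) (U : I -> set M)
    (X : set M) : Prop :=
  connected X /\
  exists2 x, frontier (closure X) x &
    forall i, ~ (connected_component (frontier (closure X)) x `<=` U i).

Definition essential (M : topologicalType) (I : Type) (U : I -> set M)
    (i : I) : Prop :=
  \bigcup_(j in [set j | j <> i]) U j <> setT.

Definition support_of (R : realType) (M : topologicalType) (f : M -> R) : set M :=
  closure [set x | f x != 0].

(* Local finiteness makes the sum over I have finite support at every point. *)
Definition positive_collection (R : realType) (M : topologicalType)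
    (S : smooth_surface R M) (I : choiceType) (f : I -> M -> R) : Prop :=
  [/\ locally_finite_family (fun i => support_of (f i)),
      forall i, smooth_fun S (f i),
      forall i x, 0 <= f i x &
      forall x, 1 <= \sum_(i \in [set: I]) f i x].

Definition subordinate (R : realType) (M : topologicalType) (I : Type)
    (f : I -> M -> R) (U : I -> set M) : Prop :=
  forall i, support_of (f i) `<=` U i.

(* Main.v *)
From HB Require Import structures.
Require Import Defs.
From mathcomp Require Import all_boot all_order all_algebra.
From mathcomp Require Import finmap.
From mathcomp Require Import all_classical all_reals all_analysis.
From mathcomp Require Import measurable_realfun ring lra.

(** The hub U_1 is a rectangle in one chart, and f_1 (the hill) is a function
    on it equal to 1 on a plateau and decreasing to 0. By the coarea formula the
    integral of |{f_i, f_1}| is the integral over t of the total variation of f_i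
    along the level {f_1 = t}. On that level the other functions must add up to at
    least 1 - t; if each of them vanishes somewhere on it, its variation is at least
    twice its maximum. A level therefore costs at least 2 (1 - t), which is nearly
    reached by sharing the weight 1 - t between n + 1 functions (the shores) which
    vanish on disjoint arcs: n of them are present at every point, so each only
    has to reach (1 - t) / n. The cost of the level is 2 (1 - t) (n + 1) / n, and
    the total is (n + 1) / n <= 1 + eps as soon as 1 / n <= eps.

    The shapes are chosen so that everything is explicit. All the arcs lie in a
    sector to the right of the centre where the hill depends on x only, along the
    rays y = i x for 0 <= i <= n. There the coarea formula becomes Tonelli's theorem
    and the fundamental theorem of calculus ([integral_jac]); outside the arcs the
    shores are functions of the hill and the brackets vanish ([jac_shore_hill]). The
    i-th shore is supported in a domain bounded by a thin parabola around its ray.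
    It is a disc ([graph_region_disc]), it misses the centre, so that the hub is
    essential, and it misses a point of the right side of the hub. This side is
    a connected part of the frontier contained in no member, so that the hub is
    confined ([hub_confined]).

    The rest of the surface is covered by a locally finite family of small discs
    disjoint from the closed rectangle, by compact exhaustion ([far_cover]). The
    chart is the first nonempty chart of the atlas, so that no change of variables
    is needed: on the hub the integral is one integral over the plane, and a bracket
    times the density of the form is a Jacobian determinant
    ([poisson_bracket_jac]). *)

Set Implicit Arguments.
Unset Strict Implicit.
Unset Printing Implicit Defensive.

Import Order.TTheory GRing.Theory Num.Theory.
Import numFieldNormedType.Exports.

Local Open Scope classical_set_scope.
Local Open Scope ring_scope.

(** * Differentiability of functions with continuous partial derivatives *)

Lemma derive_fst (R : realType) (V : normedModType R) (F : plane R -> V) (x y : R) :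
  derivable F (x, y) (1, 0) ->
  is_derive x 1 (fun t => F (t, y)) ('D_(1, 0) F (x, y)).
Proof.
have E : (fun h : R => h^-1 *: (F (h *: ((1, 0) : plane R) + (x, y)) - F (x, y))) =
    (fun h : R => h^-1 *: (F (h *: (1 : R) + x, y) - F (x, y))).
  apply/funext => h; congr (_ *: (F _ - _)).
  by congr pair; rewrite /= /GRing.scale/= ?mulr0 ?add0r.
by move=> dF; split; [move: dF; rewrite /derivable E|rewrite /derive E].
Qed.

Lemma derive_snd (R : realType) (V : normedModType R) (F : plane R -> V) (x y : R) :
  derivable F (x, y) (0, 1) ->
  is_derive y 1 (fun t => F (x, t)) ('D_(0, 1) F (x, y)).
Proof.
have E : (fun h : R => h^-1 *: (F (h *: ((0, 1) : plane R) + (x, y)) - F (x, y))) =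
    (fun h : R => h^-1 *: (F (x, h *: (1 : R) + y) - F (x, y))).
  apply/funext => h; congr (_ *: (F _ - _)).
  by congr pair; rewrite /= /GRing.scale/= ?mulr0 ?add0r.
by move=> dF; split; [move: dF; rewrite /derivable E|rewrite /derive E].
Qed.

(** Mean value inequality for g x - A x. The points a and b may come in either
    order, since it is applied to increments of unknown sign. *)
Lemma increment_bound (R : realType) (g dg : R -> R) (a b A e : R) :
  (forall x, `|x - a| <= `|b - a| -> is_derive x 1 g (dg x)) ->
  (forall x, `|x - a| <= `|b - a| -> `|dg x - A| <= e) ->
  `|g b - g a - A * (b - a)| <= e * `|b - a|.
Proof.
move=> dgP dgA.
have cg c d : (forall x, x \in `[c, d]%R -> `|x - a| <= `|b - a|) ->
    {within `[c, d], continuous g}.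
  move=> cd; apply: derivable_within_continuous => x /cd xcd.
  by have [] := dgP x xcd.
have [ab|ba] := leP a b.
  have H x : x \in `[a, b]%R -> `|x - a| <= `|b - a|.
    by rewrite in_itv/= => /andP[? ?]; rewrite !ger0_norm ?lerD2r ?subr_ge0.
  have H' x : x \in `]a, b[%R -> is_derive x 1 g (dg x).
    by move=> /subset_itv_oo_cc xab; apply/dgP/H.
  have [c cab ->] := MVT_segment ab H' (cg _ _ H).
  by rewrite -mulrBl normrM ler_wpM2r// dgA// H.
have H x : x \in `[b, a]%R -> `|x - a| <= `|b - a|.
  rewrite in_itv/= => /andP[? ?].
  by rewrite !ler0_norm ?subr_le0 ?(ltW ba)// !opprB lerB.
have H' x : x \in `]b, a[%R -> is_derive x 1 g (dg x).
  by move=> /subset_itv_oo_cc xab; apply/dgP/H.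
have [c cab E] := MVT_segment (ltW ba) H' (cg _ _ H).
rewrite -(opprB (g a)) E -mulrN opprB -mulrBl normrM.
by rewrite ler_wpM2r// dgA// H.
Qed.

Lemma plane_normE (R : realType) (p : plane R) :
  `|p| = Num.max `|p.1| `|p.2|.
Proof. exact: prod_normE. Qed.

(** The plane carries the maximum norm, so squares form a basis of neighbourhoods. *)
Lemma plane_nbhsP (R : realType) (p : plane R) (P : set (plane R)) :
  nbhs p P <->
  exists2 r : R, 0 < r &
    forall q : plane R, `|q.1 - p.1| < r -> `|q.2 - p.2| < r -> P q.
Proof.
have E (q : plane R) (r : R) :
    (`|p - q| < r) = (`|q.1 - p.1| < r) && (`|q.2 - p.2| < r).
  by rewrite plane_normE gt_max/= [X in `|X| < r]/GRing.add/= distrC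
             [in X in _ && X]distrC.
split.
  move=> /nbhs_normP[r/= r0 Hr]; exists r => // q q1 q2.
  by apply: Hr; rewrite /ball_/= E q1.
move=> [r r0 Hr]; apply: (nbhs_normP p P).2; exists r => //= q.
by rewrite /ball_/= E => /andP[]; exact: Hr.
Qed.

(** The increment from p to p + h is a vertical step followed by a horizontal
    one, and the mean value inequality controls each. This is what turns the
    directional derivatives of [Ck_on] into differentials. *)
Lemma C1_differentiable (R : realType) (F : plane R -> R) (p : plane R) :
  (\forall q \near p, derivable F q (1, 0)) ->
  (\forall q \near p, derivable F q (0, 1)) ->
  {for p, continuous ('D_(1, 0) F)} -> {for p, continuous ('D_(0, 1) F)} ->
  differentiable F p.
Proof.
move=> d1 d2 c1 c2.
pose A := 'D_(1, 0) F p; pose B := 'D_(0, 1) F p.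
pose df (h : plane R) := h.1 * A + h.2 * B.
have lin_df : linear df.
  by move=> a u v; rewrite /df/= /GRing.scale/=; ring.
pose dfM := GRing.isLinear.Build _ _ _ _ _ lin_df.
pose dfL : {linear plane R -> R} := HB.pack df dfM.
have cdf : continuous dfL.
  move=> q; apply: cvgD; apply: cvgM; [exact: cvg_fst|exact: cvg_cst|
    exact: cvg_snd|exact: cvg_cst].
have dfE : F \o shift p = cst (F p) + dfL +o_ 0 id.
  apply/eqaddoP => e e0.
  have e20 : 0 < e / 2 by rewrite divr_gt0.
  have : \forall q \near p, [/\ derivable F q (1, 0), derivable F q (0, 1),
      `|'D_(1, 0) F q - A| <= e / 2 & `|'D_(0, 1) F q - B| <= e / 2].
    move/cvgrPdist_le : c1 => /(_ _ e20) c1.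
    move/cvgrPdist_le : c2 => /(_ _ e20) c2.
    apply: filterS (filterI (filterI d1 d2) (filterI c1 c2)).
    move=> q [[q1 q2] [q3 q4]]; rewrite /= distrC in q3; rewrite /= distrC in q4.
    by split; [exact: q1|exact: q2|exact: q3|exact: q4].
  move=> /plane_nbhsP[r/= r0 Hr].
  apply: (plane_nbhsP 0 _).2; exists r => //= h; rewrite !subr0 => h1r h2r.
  have [h1 h2] : `|h.1| <= `|h| /\ `|h.2| <= `|h|.
    by rewrite plane_normE; split; rewrite le_max lexx ?orbT.
  have nr (a b : R) : `|a| <= `|h.1| -> `|b| <= `|h.2| ->
      [/\ derivable F (p.1 + a, p.2 + b) (1, 0),
          derivable F (p.1 + a, p.2 + b) (0, 1),
          `|'D_(1, 0) F (p.1 + a, p.2 + b) - A| <= e / 2 &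
          `|'D_(0, 1) F (p.1 + a, p.2 + b) - B| <= e / 2].
    move=> ab bb; apply: Hr => /=.
      by rewrite addrC addKr (le_lt_trans ab).
    by rewrite addrC addKr (le_lt_trans bb).
  have E1 := @increment_bound R (fun t => F (t, p.2 + h.2))
    (fun t => 'D_(1, 0) F (t, p.2 + h.2)) p.1 (p.1 + h.1) A (e / 2).
  have E2 := @increment_bound R (fun t => F (p.1, t))
    (fun t => 'D_(0, 1) F (p.1, t)) p.2 (p.2 + h.2) B (e / 2).
  rewrite /= ![_ + h.1 - _]addrAC !subrr !add0r in E1.
  rewrite /= ![_ + h.2 - _]addrAC !subrr !add0r in E2.
  have {}E1 : `|F (p.1 + h.1, p.2 + h.2) - F (p.1, p.2 + h.2) - A * h.1|
      <= e / 2 * `|h|.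
    apply: le_trans (ler_wpM2l (ltW e20) h1); apply: E1 => x xh.
      apply: derive_fst.
      by have [+ _ _ _] := nr (x - p.1) h.2 xh (lexx _); rewrite [p.1 + (_ - _)]addrC subrK.
    by have [_ _ + _] := nr (x - p.1) h.2 xh (lexx _); rewrite [p.1 + (_ - _)]addrC subrK.
  have h0 : `|0 : R| <= `|h.1| by rewrite normr0.
  have {}E2 : `|F (p.1, p.2 + h.2) - F (p.1, p.2) - B * h.2|
      <= e / 2 * `|h|.
    apply: le_trans (ler_wpM2l (ltW e20) h2); apply: E2 => x xh.
      apply: derive_snd.
      have [_ + _ _] := nr 0 (x - p.2) h0 xh.
      by rewrite addr0 [p.2 + _]addrC subrK.
    have [_ _ _ +] := nr 0 (x - p.2) h0 xh.
    by rewrite addr0 [p.2 + _]addrC subrK.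
  rewrite [e]splitr mulrDl.
  apply: le_trans (lerD E1 E2); apply: le_trans (ler_normD _ _).
  have hp : shift p h = (p.1 + h.1, p.2 + h.2) by rewrite /shift/= addrC.
  have pE : F p = F (p.1, p.2) by case: (p).
  rewrite le_eqVlt; apply/orP; left; apply/eqP; congr (`|_|).
  rewrite -[LHS]/(F (shift p h) - (F p + df h)) hp pE /df.
  by ring.
have dE : 'd F p = dfL :> (plane R -> R) by exact: diff_unique.
by apply/diff_locallyP; rewrite dE; split.
Qed.

(** * Smooth functions on open subsets of the plane *)

Section SmoothOn.
Context (R : realType) (O : set (plane R)) (oO : open O).

Lemma within_openP (V : normedModType R) (F : plane R -> V) :
  {within O, continuous F} <-> forall p, O p -> {for p, continuous F}.
Proof.
rewrite continuous_open_subspace//; split=> H p.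
  by move=> Op; apply: H; rewrite inE.
by rewrite inE; apply: H.
Qed.

Lemma Ck_on_ext (V : normedModType R) k (F G : plane R -> V) :
  (forall p, O p -> F p = G p) -> Ck_on O k F -> Ck_on O k G.
Proof.
elim: k F G => [|k IH] F G FG /=.
  rewrite !within_openP => cF p Op.
  have pFG : \forall q \near p, F q = G q.
    by apply: filterS (open_nbhs_nbhs (conj oO Op)) => q Oq; exact: FG.
  have := cF _ Op; rewrite /prop_for /continuous_at -FG//.
  by apply: cvg_trans; apply: near_eq_cvg; apply: filterS pFG => q ->.
have pFG p : O p -> \forall q \near p, F q = G q.
  by move=> Op; apply: filterS (open_nbhs_nbhs (conj oO Op)) => q Oq; exact: FG.
move=> [dF CF]; split=> [p v Op|v].
  by apply: near_eq_derivable (pFG _ Op) (dF _ _ Op).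
apply: IH (CF v) => p Op.
exact: near_eq_derive (pFG _ Op).
Qed.

Lemma smooth_on_ext (V : normedModType R) (F G : plane R -> V) :
  (forall p, O p -> F p = G p) -> smooth_on O F -> smooth_on O G.
Proof. by move=> FG sF k; apply: Ck_on_ext FG (sF k). Qed.

Lemma smooth_on_continuous (V : normedModType R) (F : plane R -> V) :
  smooth_on O F -> forall p, O p -> {for p, continuous F}.
Proof. by move=> /(_ 0)/= /within_openP. Qed.

Lemma smooth_on_derivable (V : normedModType R) (F : plane R -> V) :
  smooth_on O F -> forall p v, O p -> derivable F p v.
Proof. by move=> /(_ 1)/= []. Qed.

Lemma smooth_on_derive (V : normedModType R) (F : plane R -> V) :
  smooth_on O F -> forall v, smooth_on O ('D_v F).
Proof. by move=> sF v k; have /= [_] := sF k.+1; apply. Qed.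

Lemma smooth_on_differentiable (F : plane R -> R) :
  smooth_on O F -> forall p, O p -> differentiable F p.
Proof.
move=> sF p Op; apply: C1_differentiable.
- apply: filterS (open_nbhs_nbhs (conj oO Op)) => q Oq.
  exact: smooth_on_derivable.
- apply: filterS (open_nbhs_nbhs (conj oO Op)) => q Oq.
  exact: smooth_on_derivable.
- exact: (smooth_on_continuous (smooth_on_derive sF _)).
- exact: (smooth_on_continuous (smooth_on_derive sF _)).
Qed.

Lemma Ck_onD (V : normedModType R) k (F G : plane R -> V) :
  Ck_on O k F -> Ck_on O k G -> Ck_on O k (F + G).
Proof.
elim: k F G => [|k IH] F G /=.
  by rewrite !within_openP => cF cG p Op; apply: continuousD; [exact: cF|exact: cG].
move=> [dF cF] [dG cG]; split=> [p v Op|v].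
  by apply: derivableD; [exact: dF|exact: dG].
apply: Ck_on_ext (IH _ _ (cF v) (cG v)) => p Op.
by rewrite deriveD; [|exact: dF|exact: dG].
Qed.

Lemma smooth_on_cst (V : normedModType R) (c : V) : smooth_on O (cst c : plane R -> V).
Proof.
move=> k; elim: k c => [|k IH] c /=.
  by rewrite !within_openP => p Op; exact: cvg_cst.
split=> [p v Op|v]; first exact: derivable_cst.
by apply: Ck_on_ext (IH 0) => p Op; rewrite derive_cst.
Qed.

Lemma smooth_onD (V : normedModType R) (F G : plane R -> V) :
  smooth_on O F -> smooth_on O G -> smooth_on O (F + G).
Proof. by move=> sF sG k; apply: Ck_onD; [exact: sF|exact: sG]. Qed.

(** Both factors are smooth, not just of class C^k, so that the induction hypothesis
    applies to F * D_v G and to G * D_v F. *)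
Lemma smooth_onM (F G : plane R -> R) :
  smooth_on O F -> smooth_on O G -> smooth_on O (F * G).
Proof.
move=> sF sG k; elim: k F G sF sG => [|k IH] F G sF sG /=.
  by rewrite !within_openP => p Op; apply: continuousM; apply: smooth_on_continuous.
have [dF dG] := (smooth_on_derivable sF, smooth_on_derivable sG).
split=> [p v Op|v].
  by apply: derivableM; [exact: dF|exact: dG].
apply: Ck_on_ext (Ck_onD (IH _ _ sF (smooth_on_derive sG v))
                         (IH _ _ sG (smooth_on_derive sF v))) => p Op.
by rewrite deriveM; [|exact: dF|exact: dG].
Qed.

Lemma smooth_onN (F : plane R -> R) : smooth_on O F -> smooth_on O (- F).
Proof.
move=> sF; have s1 : smooth_on O (cst (-1) : plane R -> R) by exact: smooth_on_cst.
apply: smooth_on_ext (smooth_onM s1 sF) => p Op.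
by rewrite -[LHS]/(-1 * F p) mulN1r.
Qed.

Lemma smooth_onB (F G : plane R -> R) :
  smooth_on O F -> smooth_on O G -> smooth_on O (F - G).
Proof. by move=> sF sG; apply: smooth_onD sF (smooth_onN sG). Qed.

Lemma smooth_on_linear (V : normedModType R) (L : {linear plane R -> V}) :
  continuous L -> smooth_on O L.
Proof.
move=> cL k; case: k => [|k] /=; first by rewrite within_openP => p _; exact: cL.
have dL p : differentiable L p by exact: linear_differentiable.
split=> [p v _|v]; first exact: diff_derivable.
apply: Ck_on_ext (smooth_on_cst (L v) k) => p Op.
by rewrite deriveE// diff_lin.
Qed.

Lemma smooth_on_fst : smooth_on O (fst : plane R -> R).
Proof. by apply: smooth_on_linear => p; exact: cvg_fst. Qed.

Lemma smooth_on_snd : smooth_on O (snd : plane R -> R).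
Proof. by apply: smooth_on_linear => p; exact: cvg_snd. Qed.

(** If the directional derivatives of the members of a family are combinations of
    members with smooth coefficients, all the members are smooth: the class of
    products Phi j * B with B smooth is then closed under derivation up to sums.
    Composition with a fixed map produces such families, which reduces the chain
    rule at all orders to the first order. *)
Lemma smooth_on_family (J : Type) (Phi : J -> plane R -> R) :
  (forall j p, O p -> {for p, continuous (Phi j)}) ->
  (forall j p v, O p -> derivable (Phi j) p v) ->
  (forall j v, exists j1 j2 C1 C2, [/\ smooth_on O C1, smooth_on O C2 &
    forall p, O p -> 'D_v (Phi j) p = Phi j1 p * C1 p + Phi j2 p * C2 p]) ->
  forall j, smooth_on O (Phi j).
Proof.
move=> cPhi dPhi DPhi j k.
suff H B : smooth_on O B -> Ck_on O k (Phi j * B).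
  have s1 : smooth_on O (cst 1 : plane R -> R) by exact: smooth_on_cst.
  apply: Ck_on_ext (H _ s1) => p Op.
  by rewrite -[LHS]/(Phi j p * 1) mulr1.
elim: k j B => [|k IH] j B sB /=.
  rewrite !within_openP => p Op; apply: continuousM; first exact: cPhi.
  exact: smooth_on_continuous.
have dB := smooth_on_derivable sB.
split=> [p v Op|v].
  by apply: derivableM; [exact: dPhi|exact: dB].
have [j1 [j2 [C1 [C2 [sC1 sC2 E]]]]] := DPhi j v.
apply: Ck_on_ext (Ck_onD (IH j _ (smooth_on_derive sB v))
  (Ck_onD (IH j1 _ (smooth_onM sC1 sB)) (IH j2 _ (smooth_onM sC2 sB)))) => p Op.
rewrite deriveM; [|exact: dPhi|exact: dB].
rewrite E// -[LHS]/(Phi j p * 'D_v B p +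
  (Phi j1 p * (C1 p * B p) + Phi j2 p * (C2 p * B p))).
by rewrite /GRing.scale/=; ring.
Qed.

End SmoothOn.

Lemma smooth_onW (R : realType) (V : normedModType R) (O O' : set (plane R))
  (F : plane R -> V) : open O -> open O' -> O' `<=` O -> smooth_on O F -> smooth_on O' F.
Proof.
move=> oO oO' O'O sF k; elim: k F sF => [|k IH] F sF /=.
  by rewrite within_openP// => p /O'O Op; exact: smooth_on_continuous Op.
split=> [p v /O'O Op|v]; first exact: smooth_on_derivable.
by apply: IH; apply: smooth_on_derive.
Qed.

(** Smoothness can be tested near each point; this is how functions defined by
    gluing with 0 are handled. *)
Lemma smooth_on_local (R : realType) (V : normedModType R) (O : set (plane R))
    (F : plane R -> V) : open O ->
  (forall p, O p -> exists U, [/\ open U, U p & smooth_on U F]) ->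
  smooth_on O F.
Proof.
move=> oO H k; elim: k F H => [|k IH] F H /=.
  rewrite within_openP// => p /H[U [oU Up sF]]; exact: smooth_on_continuous Up.
split=> [p v /H[U [oU Up sF]]|v]; first exact: smooth_on_derivable Up.
apply: IH => p /H[U [oU Up sF]]; exists U; split => //.
exact: smooth_on_derive.
Qed.

(** * Composition of smooth functions *)

Lemma cvg_plane (R : realType) (T : Type) (F : set_system T) (FF : Filter F)
    (f g : T -> R) (a b : R) : f @ F --> a -> g @ F --> b ->
  (fun t => (f t, g t) : plane R) @ F --> ((a, b) : plane R).
Proof. by move=> fa gb; exact: (@cvg_pair T R R F (nbhs a) (nbhs b) FF _ _ f g fa gb). Qed.

Lemma derive_pair (R : realType) (F G : plane R -> R) (p v : plane R) :
  derivable F p v -> derivable G p v ->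
  derivable (fun q => (F q, G q) : plane R) p v /\
  'D_v (fun q => (F q, G q) : plane R) p = ('D_v F p, 'D_v G p).
Proof.
move=> dF dG.
have H : (fun h : R => h^-1 *: ((F (h *: v + p), G (h *: v + p)) -
    (F p, G p) : plane R)) @ 0^' --> (('D_v F p, 'D_v G p) : plane R).
  exact: (cvg_plane (f := fun h : R => h^-1 *: (F (h *: v + p) - F p))
    (g := fun h : R => h^-1 *: (G (h *: v + p) - G p)) _ dF dG).
by split; [exact: (cvgP _ H)|exact: (cvg_lim (@norm_hausdorff _ _) H)].
Qed.

Lemma derive_component (R : realType) (L : {linear plane R -> R}) (F : plane R -> plane R)
    (p v : plane R) : continuous L ->
  derivable F p v ->
  derivable (L \o F) p v /\ 'D_v (L \o F) p = L ('D_v F p).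
Proof.
move=> cL dF.
have H : (fun h : R => h^-1 *: ((L \o F) (h *: v + p) - (L \o F) p)) @ 0^' -->
    L ('D_v F p).
  have -> : (fun h : R => h^-1 *: ((L \o F) (h *: v + p) - (L \o F) p)) =
      L \o (fun h : R => h^-1 *: (F (h *: v + p) - F p)).
    apply/funext => h; rewrite /= linearZ/=; congr (_ *: _).
    exact/esym/(linearB L).
  by apply: continuous_cvg; [exact: cL|exact: dF].
by split; [exact: (cvgP _ H)|exact: (cvg_lim (@norm_hausdorff _ _) H)].
Qed.

Section SmoothComp.
Context (R : realType) (O : set (plane R)) (oO : open O).

Lemma smooth_on_pair (F G : plane R -> R) :
  smooth_on O F -> smooth_on O G -> smooth_on O (fun p => (F p, G p) : plane R).
Proof.
move=> sF sG k; elim: k F G sF sG => [|k IH] F G sF sG /=.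
  rewrite (within_openP oO) => p Op; apply: cvg_plane;
    [exact: (smooth_on_continuous oO sF Op)|exact: (smooth_on_continuous oO sG Op)].
have D p v : O p -> derivable (fun q => (F q, G q) : plane R) p v /\
  'D_v (fun q => (F q, G q) : plane R) p = ('D_v F p, 'D_v G p).
  move=> Op; apply: derive_pair; exact: smooth_on_derivable Op.
split=> [p v Op|v]; first by have [] := D p v Op.
apply: Ck_on_ext (IH _ _ (smooth_on_derive sF v) (smooth_on_derive sG v)) => //.
by move=> p Op; have [_ ->] := D p v Op.
Qed.

Lemma smooth_on_component (L : {linear plane R -> R}) (F : plane R -> plane R) :
  continuous L -> smooth_on O F -> smooth_on O (L \o F).
Proof.
move=> cL sF k; elim: k F sF => [|k IH] F sF /=.
  rewrite (within_openP oO) => p Op.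
  by apply: continuous_comp; [exact: (smooth_on_continuous oO sF Op)|exact: cL].
have D p v : O p -> derivable (L \o F) p v /\ 'D_v (L \o F) p = L ('D_v F p).
  move=> Op; apply: derive_component => //; exact: smooth_on_derivable Op.
split=> [p v Op|v]; first by have [] := D p v Op.
apply: Ck_on_ext (IH _ (smooth_on_derive sF v)) => //.
by move=> p Op; have [_ ->] := D p v Op.
Qed.

Lemma smooth_on_comp1 (F : plane R -> plane R) :
  smooth_on O F -> smooth_on O (fun p => (F p).1).
Proof. by apply: (@smooth_on_component fst) => p; exact: cvg_fst. Qed.

Lemma smooth_on_comp2 (F : plane R -> plane R) :
  smooth_on O F -> smooth_on O (fun p => (F p).2).
Proof. by apply: (@smooth_on_component snd) => p; exact: cvg_snd. Qed.

Lemma derive_scalar_comp (h : R -> R) (F : plane R -> R) (dh : R) p v :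
  is_derive (F p) 1 h dh -> differentiable F p ->
  differentiable (h \o F) p /\ 'D_v (h \o F) p = dh * 'D_v F p.
Proof.
move=> [hd hE] dF; have dhF : differentiable h (F p) by apply/derivable1_diffP.
have dc : differentiable (h \o F) p by exact: differentiable_comp.
split => //; rewrite deriveE// diff_comp//= -(deriveE v dF).
rewrite -[X in 'd h _ X]mulr1 [LHS]linearZ/= mulrC; congr (_ * _).
by rewrite -hE deriveE.
Qed.

(** The powers of 1 / sqrt F form a family closed under derivation; both the square
    root and the inverse of F are products of its members and F. *)
Lemma smooth_on_invsqrt (F : plane R -> R) :
  (forall p, O p -> 0 < F p) -> smooth_on O F ->
  forall n, smooth_on O (fun p => (Num.sqrt (F p))^-1 ^+ n).
Proof.
move=> F0 sF; have dF := smooth_on_differentiable oO sF.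
have D n (x : R) : 0 < x -> is_derive x 1 (fun t : R => (Num.sqrt t)^-1 ^+ n)
    (- (n%:R / 2) * (Num.sqrt x)^-1 ^+ n.+2).
  move=> x0; have s0 : Num.sqrt x != 0 by rewrite gt_eqF// sqrtr_gt0.
  have ds := is_derive1_sqrt x0.
  have dV : is_derive x 1 (fun t : R => (Num.sqrt t)^-1)
     (- (Num.sqrt x) ^- 2 *: (2 * Num.sqrt x)^-1).
    split; first by apply: derivableV.
    by rewrite deriveV//; congr (_ *: _); apply: derive_val.
  have -> : (fun t : R => (Num.sqrt t)^-1 ^+ n) = (fun t : R => (Num.sqrt t)^-1) ^+ n.
    by apply/funext => t; rewrite exprfctE.
  case: n => [|n].
    rewrite mul0r oppr0 mul0r expr0; exact: is_derive_cst.
  apply: is_derive_eq.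
  rewrite /GRing.scale/= !invfM; move: (Num.sqrt x)^-1 => y.
  by rewrite -[n.+3]addn3 exprD; field.
have H n p v (Op : O p) := derive_scalar_comp v (D n (F p) (F0 p Op)) (dF p Op).
apply: (smooth_on_family oO).
- move=> n p Op; apply: differentiable_continuous; by have [] := H n p 0 Op.
- move=> n p v Op; apply: diff_derivable; by have [] := H n p 0 Op.
- move=> n v; exists n.+2, n, (cst (- (n%:R / 2)) * 'D_v F), (cst 0); split.
  + by apply: smooth_onM; [|exact: smooth_on_cst|exact: smooth_on_derive].
  + exact: smooth_on_cst.
  + move=> p Op; have [_ ->] := H n p v Op.
    rewrite mulr0 addr0.
    rewrite -[RHS]/((Num.sqrt (F p))^-1 ^+ n.+2 * (- (n%:R / 2) * 'D_v F p)).
    by ring.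
Qed.

Lemma smooth_on_sqrt (F : plane R -> R) :
  (forall p, O p -> 0 < F p) -> smooth_on O F ->
  smooth_on O (fun p => Num.sqrt (F p)).
Proof.
move=> F0 sF; apply: smooth_on_ext (smooth_onM oO sF (smooth_on_invsqrt F0 sF 1)) => //.
move=> p Op; rewrite -[LHS]/(F p * (Num.sqrt (F p))^-1 ^+ 1) expr1.
rewrite -{1}[F p]sqr_sqrtr ?ltW ?F0// expr2 mulfK//.
by rewrite gt_eqF// sqrtr_gt0 F0.
Qed.

Lemma smooth_on_inv (F : plane R -> R) :
  (forall p, O p -> 0 < F p) -> smooth_on O F ->
  smooth_on O (fun p => (F p)^-1).
Proof.
move=> F0 sF; apply: smooth_on_ext (smooth_on_invsqrt F0 sF 2) => //.
by move=> p Op; rewrite exprVn sqr_sqrtr// ltW ?F0.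
Qed.

End SmoothComp.

Lemma planeE (R : realType) (p : plane R) :
  p = p.1 *: ((1, 0) : plane R) + p.2 *: ((0, 1) : plane R).
Proof.
by case: p => a b; congr pair; rewrite /= /GRing.scale/= ?(mulr0, mulr1, addr0, add0r).
Qed.

(** For fixed F, the composites of F with all the smooth functions on O' form a
    family closed under derivation in the sense of [smooth_on_family]: the
    coefficients are the derivatives of the two components of F. *)
Lemma smooth_on_comp_scalar (R : realType) (O O' : set (plane R)) (oO : open O) (oO' : open O')
    (F : plane R -> plane R) (G : plane R -> R) :
  (forall p, O p -> O' (F p)) -> smooth_on O F -> smooth_on O' G ->
  smooth_on O (G \o F).
Proof.
move=> FO sF sG.
have sF1 := smooth_on_comp1 oO sF; have sF2 := smooth_on_comp2 oO sF.
have dF p : O p -> differentiable F p.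
  move=> Op.
  have -> : F = (fun q => ((F q).1, (F q).2)) by apply/funext => q; case: (F q).
  by apply: differentiable_pair; exact: (smooth_on_differentiable oO _ Op).
pose J := {A : plane R -> R | smooth_on O' A}.
have H (A : J) p v : O p -> differentiable (sval A \o F) p /\
    'D_v (sval A \o F) p = 'D_(1, 0) (sval A) (F p) * 'D_v (fun q => (F q).1) p +
     'D_(0, 1) (sval A) (F p) * 'D_v (fun q => (F q).2) p.
  move=> Op; case: A => A sA /=.
  have dA : differentiable A (F p).
    by apply: (smooth_on_differentiable oO' sA); exact: FO.
  have dFp := dF _ Op.
  have dc : differentiable (A \o F) p by exact: differentiable_comp.
  split => //; rewrite deriveE// diff_comp//= -(deriveE v dFp).
  have c1 : continuous (fst : plane R -> R) by move=> q; exact: cvg_fst.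
  have c2 : continuous (snd : plane R -> R) by move=> q; exact: cvg_snd.
  have [_ E1] := derive_component (L := fst) c1 (smooth_on_derivable (v := v) sF Op).
  have [_ E2] := derive_component (L := snd) c2 (smooth_on_derivable (v := v) sF Op).
  rewrite [X in 'd A _ X]planeE linearD !linearZ/=.
  rewrite -!(deriveE _ dA) E1 E2 mulrC; congr (_ + _).
  exact: mulrC.
apply: (@smooth_on_family R O oO J (fun A => sval A \o F) _ _ _ (exist _ G sG)).
- move=> A p Op; apply: differentiable_continuous; by have [] := H A p 0 Op.
- move=> A p v Op; apply: diff_derivable; by have [] := H A p 0 Op.
- move=> A v.
  exists (exist _ _ (smooth_on_derive (svalP A) (1, 0))).
  exists (exist _ _ (smooth_on_derive (svalP A) (0, 1))).
  exists ('D_v (fun q => (F q).1)), ('D_v (fun q => (F q).2)); split.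
  + exact: smooth_on_derive.
  + exact: smooth_on_derive.
  + by move=> p Op; have [_ ->] := H A p v Op.
Qed.

Lemma smooth_on_comp (R : realType) (O O' : set (plane R)) (oO : open O) (oO' : open O')
    (F G : plane R -> plane R) :
  (forall p, O p -> O' (F p)) -> smooth_on O F -> smooth_on O' G ->
  smooth_on O (G \o F).
Proof.
move=> FO sF sG.
apply: (@smooth_on_ext _ _ oO _ (fun p => ((G (F p)).1, (G (F p)).2))).
  by move=> p _ /=; case: (G (F p)).
apply: smooth_on_pair => //.
- exact: (smooth_on_comp_scalar oO oO' FO sF (smooth_on_comp1 oO' sG)).
- exact: (smooth_on_comp_scalar oO oO' FO sF (smooth_on_comp2 oO' sG)).
Qed.

(** * A smooth step *)

(** The functions x^-n exp (-1/x), extended by 0: taken together they are closed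
    under derivation. *)
Definition flat (R : realType) (n : nat) (x : R) : R :=
  if 0 < x then x^-1 ^+ n * expR (- x^-1) else 0.

Lemma flat_le0 (R : realType) n (x : R) : x <= 0 -> flat n x = 0.
Proof. by move=> x0; rewrite /flat ltNge x0. Qed.

Lemma flat_ge0 (R : realType) n (x : R) : 0 <= flat n x.
Proof.
rewrite /flat; case: ifPn => // x0.
by rewrite mulr_ge0 ?expR_ge0 ?exprn_ge0 ?invr_ge0 ?ltW.
Qed.

(** Written as exp t = (exp (t / k))^k, this is the inequality 1 + x <= exp x. *)
Lemma expR_ge_pow (R : realType) (k : nat) (t : R) : 0 <= t ->
  t ^+ k <= k%:R ^+ k * expR t.
Proof.
move=> t0; have [->|k0] := posnP k; first by rewrite !expr0 mul1r -expR0 ler_expR.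
have kR : (0 : R) < k%:R by rewrite ltr0n.
have -> : expR t = expR (t / k%:R) ^+ k.
  by rewrite -expRM_natl mulrC divfK ?gt_eqF.
rewrite -exprMn lerXn2r ?nnegrE// ?mulr_ge0 ?expR_ge0 ?ler0n//.
rewrite -ler_pdivrMl// mulrC.
by apply: le_trans (expR_ge1Dx _); rewrite lerDr.
Qed.

(** A quadratic bound: it gives the derivative 0 at the origin. *)
Lemma flat_bound (R : realType) n (x : R) :
  flat n x <= n.+2%:R ^+ n.+2 * x ^+ 2.
Proof.
rewrite /flat; case: ifPn => [x0|_]; last first.
  by rewrite mulr_ge0 ?sqr_ge0// exprn_ge0// ler0n.
have xV0 : 0 <= x^-1 by rewrite invr_ge0 ltW.
have x2 : 0 < x ^+ 2 by rewrite exprn_gt0.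
rewrite expRN ler_pdivrMr ?expR_gt0// mulrAC.
rewrite -ler_pdivrMr// -exprVn -exprD addn2.
exact: expR_ge_pow.
Qed.

Lemma is_derive_flat (R : realType) n (x : R) :
  is_derive x 1 (flat n) (- n%:R * flat n.+1 x + flat n.+2 x).
Proof.
have [x0|x0|->] := ltgtP x 0.
- rewrite !flat_le0 ?ltW// mulr0 addr0.
  apply: near_eq_is_derive (is_derive_cst 0 x 1).
  by apply: filterS (lt_nbhsl x0) => y /ltW y0; rewrite flat_le0.
- have nf : \forall y \near x, y^-1 ^+ n * expR (- y^-1) = flat n y.
    by apply: filterS (lt_nbhsr x0) => y y0; rewrite /flat y0.
  apply: near_eq_is_derive nf _.
  have dV : is_derive x 1 (fun t : R => t^-1) (- x ^- 2).
    split; first by apply: derivableV; rewrite ?gt_eqF.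
    by rewrite deriveV ?gt_eqF// derive_id /GRing.scale/= mulr1.
  have -> : (fun y : R => y^-1 ^+ n * expR (- y^-1)) =
     (fun y : R => y^-1) ^+ n * (expR \o (- (fun y : R => y^-1))).
    by apply/funext => t; rewrite /= exprfctE.
  have dE : is_derive x 1 (expR \o (- (fun y : R => y^-1)))
     (x ^- 2 * expR (- x^-1)).
    apply: is_derive_eq.
    by rewrite opprK /GRing.scale/= mulrC.
  case: n => [|n].
    rewrite expr0 mul1r; apply: is_derive_eq.
    by rewrite /flat x0 oppr0 mul0r add0r exprVn.
  apply: is_derive_eq.
  rewrite /flat x0 /GRing.scale/= !fctE.
  have -> : x ^- 2 = x^-1 ^+ 2 by rewrite exprVn.
  move: (expR _) => E; move: x^-1 => y.
  by rewrite (exprS y n.+2) (exprS y n.+1) (exprS y n); ring.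
- rewrite !flat_le0// mulr0 addr0.
  have H : (fun h : R => h^-1 *: (flat n (h *: 1 + 0) - flat n 0)) @ 0^' --> (0 : R).
    apply/cvgr0Pnorm_le => e e0; near=> h.
    have C0 : 0 < n.+2%:R ^+ n.+2 :> R by rewrite exprn_gt0.
    rewrite (flat_le0 _ (lexx 0)) subr0 addr0 /GRing.scale/= mulr1.
    rewrite normrM normfV ger0_norm ?flat_ge0//.
    have h0 : 0 < `|h| by rewrite normr_gt0; near: h; exact: nbhs_dnbhs_neq.
    rewrite mulrC ler_pdivrMr//; apply: le_trans (flat_bound n h) _.
    rewrite -real_normK ?num_real// expr2 mulrA ler_wpM2r//.
    rewrite -ler_pdivlMl// ltW// mulrC.
    by near: h; apply: dnbhs0_lt; rewrite divr_gt0.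
  split; [exact: (cvgP _ H)|exact: (cvg_lim (@norm_hausdorff _ _) H)].
Unshelve. all: by end_near. Qed.

Lemma flat_homo (R : realType) (x y : R) : x <= y -> flat 0 x <= flat 0 y.
Proof.
move=> xy; have [x0|x0] := leP x 0; first by rewrite (flat_le0 _ x0) flat_ge0.
rewrite /flat x0 (lt_le_trans x0 xy) !expr0 !mul1r ler_expR lerN2.
by rewrite lef_pV2// posrE// (lt_le_trans x0 xy).
Qed.

Lemma flat1 (R : realType) : expR 1 * flat 0 (1 : R) = 1.
Proof. by rewrite /flat ltr01 expr0 mul1r invr1 -expRD subrr expR0. Qed.

(** With e f(t) = e exp (-1/t), the inner argument is 1 for t <= 0 and at most 0 for
    t >= 1: a smooth step from 0 to 1 obtained by composition alone. *)
Definition step (R : realType) (t : R) : R :=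
  1 - expR 1 * flat 0 (1 - expR 1 * flat 0 t).

Definition dstep (R : realType) (t : R) : R :=
  expR 1 * flat 2 (1 - expR 1 * flat 0 t) * (expR 1 * flat 2 t).

Section Step.
Context (R : realType).
Implicit Types t : R.

Lemma step_le0 t : t <= 0 -> step t = 0.
Proof. by move=> t0; rewrite /step (flat_le0 _ t0) mulr0 subr0 flat1 subrr. Qed.

Lemma flat_ge1 t : 1 <= t -> 1 - expR 1 * flat 0 t <= 0.
Proof.
by move=> t1; rewrite subr_le0 -[leLHS]flat1 ler_wpM2l ?expR_ge0// flat_homo.
Qed.

Lemma step_ge1 t : 1 <= t -> step t = 1.
Proof. by move=> t1; rewrite /step (flat_le0 _ (flat_ge1 t1)) mulr0 subr0. Qed.

Lemma step_ge0 t : 0 <= step t.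
Proof.
rewrite /step subr_ge0 -[leRHS]flat1 ler_wpM2l ?expR_ge0// flat_homo//.
by rewrite lerBlDr lerDl mulr_ge0 ?expR_ge0 ?flat_ge0.
Qed.

Lemma step_le1 t : step t <= 1.
Proof. by rewrite /step lerBlDr lerDl mulr_ge0 ?expR_ge0 ?flat_ge0. Qed.

Lemma dstep_ge0 t : 0 <= dstep t.
Proof. by rewrite !mulr_ge0 ?expR_ge0 ?flat_ge0. Qed.

Lemma dstep_le0 t : t <= 0 -> dstep t = 0.
Proof. by move=> t0; rewrite /dstep (flat_le0 2 t0) !mulr0. Qed.

Lemma dstep_ge1 t : 1 <= t -> dstep t = 0.
Proof.
by move=> t1; rewrite /dstep (flat_le0 2 (flat_ge1 t1)) mulr0 mul0r.
Qed.

Lemma is_derive_flat0 t : is_derive t 1 (flat 0) (flat 2 t).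
Proof. by apply: is_derive_eq; [exact: is_derive_flat|rewrite oppr0 mul0r add0r]. Qed.

Lemma is_derive_step t : is_derive t 1 (@step R) (dstep t).
Proof.
have -> : @step R = cst 1 - expR 1 \*: (flat 0 \o (cst 1 - expR 1 \*: flat 0)) by [].
have d0 := is_derive_flat0 t.
have d1 := is_derive_flat0 (1 - expR 1 * flat 0 t).
apply: is_derive_eq.
by rewrite /dstep /GRing.scale/=; ring.
Qed.

Lemma continuous_flat n : continuous (@flat R n).
Proof.
move=> t; apply: differentiable_continuous; apply/derivable1_diffP.
by have [] := is_derive_flat n t.
Qed.

Lemma continuous_step : continuous (@step R).
Proof.
move=> t; apply: differentiable_continuous; apply/derivable1_diffP.
by have [] := is_derive_step t.
Qed.

Lemma continuous_dstep : continuous (@dstep R).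
Proof.
move=> t; apply: cvgM; apply: cvgM;
  [exact: cvg_cst| |exact: cvg_cst|exact: continuous_flat].
apply: (@continuous_comp _ _ _ (fun t : R => 1 - expR 1 * flat 0 t) (flat 2)).
  apply: cvgB; first exact: cvg_cst.
  apply: cvgM; [exact: cvg_cst|exact: continuous_flat].
exact: continuous_flat.
Qed.

(** The derivative of [flat n] is a combination of [flat n.+1] and [flat n.+2]. *)
Lemma smooth_on_flat (O : set (plane R)) (F : plane R -> R) n : open O ->
  smooth_on O F -> smooth_on O (flat n \o F).
Proof.
move=> oO sF; have dF := smooth_on_differentiable oO sF.
have H m p v (Op : O p) := derive_scalar_comp v (is_derive_flat m (F p)) (dF p Op).
apply: (@smooth_on_family R O oO nat (fun n => flat n \o F) _ _ _ n).
- move=> m p Op; apply: differentiable_continuous; by have [] := H m p 0 Op.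
- move=> m p v Op; apply: diff_derivable; by have [] := H m p 0 Op.
- move=> m v; exists m.+1, m.+2, (cst (- m%:R) * 'D_v F), ('D_v F); split.
  + by apply: smooth_onM; [|exact: smooth_on_cst|exact: smooth_on_derive].
  + exact: smooth_on_derive.
  + move=> p Op; have [_ ->] := H m p v Op.
    rewrite -[RHS]/(flat m.+1 (F p) * (- m%:R * 'D_v F p) + flat m.+2 (F p) * 'D_v F p).
    by ring.
Qed.

Lemma smooth_on_step (O : set (plane R)) (F : plane R -> R) : open O ->
  smooth_on O F -> smooth_on O (fun p => step (F p)).
Proof.
move=> oO sF.
have sc (c : R) : smooth_on O (cst c : plane R -> R) by exact: smooth_on_cst.
have H (G : plane R -> R) : smooth_on O G ->
    smooth_on O (cst 1 - cst (expR 1) * (flat 0 \o G)).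
  by move=> sG; apply: smooth_onB (sc _) _ => //; apply: smooth_onM (sc _) _ => //;
    exact: smooth_on_flat.
exact: H (H _ sF).
Qed.

End Step.

(** * Planar domains diffeomorphic to the disc *)

Definition planar_disc (R : realType) (Omega : set (plane R)) : Prop :=
  open Omega /\ exists Phi Psi : plane R -> plane R,
  [/\ smooth_on (@unit_disc R) Phi, smooth_on Omega Psi,
      forall q, unit_disc q -> Omega (Phi q) /\ Psi (Phi q) = q &
      forall p, Omega p -> unit_disc (Psi p) /\ Phi (Psi p) = p].

Lemma open_plane_lt (R : realType) (F : plane R -> R) (a : R) :
  continuous F -> open [set p | F p < a].
Proof.
move=> cF; have -> : [set p | F p < a] = F @^-1` [set x | x < a] by [].
by apply: open_comp; [move=> p _; exact: cF|exact: open_lt].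
Qed.

Lemma open_unit_disc (R : realType) : open (@unit_disc R).
Proof.
apply: open_plane_lt => p; apply: cvgD; apply: cvgM;
  [exact: cvg_fst|exact: cvg_fst|exact: cvg_snd|exact: cvg_snd].
Qed.

(** In the sheared coordinates (x, v) with v = y - s x: the part of the strip |v| < L
    between the line x = a and the parabola x = k v^2 + h. With k = s = 0 it is an
    open rectangle. *)
Definition graph_region (R : realType) (a k h L s : R) : set (plane R) :=
  [set p | [/\ - L < p.2 - s * p.1, p.2 - s * p.1 < L, a < p.1 &
     p.1 < k * (p.2 - s * p.1) ^+ 2 + h]].

Section GraphRegion.
Context (R : realType) (a k h L s : R).
Hypotheses (L0 : 0 < L) (k0 : 0 <= k) (ah : a < h).

Let shear (p : plane R) : R := p.2 - s * p.1.

Let sm_shear (O : set (plane R)) : open O -> smooth_on O shear.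
Proof.
move=> oO; apply: smooth_onB => //; first exact: smooth_on_snd.
by apply: smooth_onM; [exact: oO|exact: smooth_on_cst|exact: smooth_on_fst].
Qed.

Let width (v : R) := k * v ^+ 2 + h - a.

Let width_gt0 v : 0 < width v.
Proof. by rewrite /width -addrA ltr_wpDl ?subr_gt0// mulr_ge0// sqr_ge0. Qed.

Let sm_width (O : set (plane R)) F : open O -> smooth_on O F ->
  smooth_on O (fun p => width (F p)).
Proof.
move=> oO sF.
have sc (c : R) : smooth_on O (cst c : plane R -> R) by exact: smooth_on_cst.
exact: (smooth_onB oO (smooth_onD oO (smooth_onM oO (sc k) (smooth_onM oO sF sF))
  (sc h)) (sc a)).
Qed.

Lemma open_graph_region : open (graph_region a k h L s).
Proof.
have oT : open [set: plane R] by exact: openT.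
have sc (c : R) : smooth_on [set: plane R] (cst c : plane R -> R) by exact: smooth_on_cst.
have cs F : smooth_on [set: plane R] F -> continuous F.
  by move=> sF p; exact: (smooth_on_continuous oT sF).
have -> : graph_region a k h L s =
    ([set p : plane R | (cst (- L) - shear) p < 0] `&`
     [set p : plane R | shear p < L]) `&`
    ([set p : plane R | (cst a - fst) p < 0] `&`
     [set p : plane R | (fst - (fun p => width (shear p))) p < a]).
  apply/seteqP; split=> p /=.
    move=> [p1 p2 p3 p4]; rewrite -![(_ - _) _]/(_ - _).
    by rewrite !subr_lt0; split; split => //; rewrite /width/shear; lra.
  rewrite -![(_ - _) _]/(_ - _) !subr_lt0 => -[[p1 p2] [p3]].
  by rewrite /width /shear => p4; split => //; lra.
do 2 apply: openI; apply: open_plane_lt; apply: cs => //.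
- by apply: smooth_onB => //; apply: sm_shear.
- exact: sm_shear.
- by apply: smooth_onB => //; exact: smooth_on_fst.
- apply: smooth_onB => //; first exact: smooth_on_fst.
  by apply: sm_width => //; exact: sm_shear.
Qed.

Let Phi (q : plane R) : plane R :=
  let x := a + width (L * q.2) * (q.1 * (Num.sqrt (1 - q.2 ^+ 2))^-1 ^+ 1 + 1) * 2^-1 in
  (x, L * q.2 + s * x).

Let Psi (p : plane R) : plane R :=
  let v := shear p in
  (Num.sqrt (1 - (v * L^-1) ^+ 2) * (2 * (p.1 - a) * (width v)^-1 - 1), v * L^-1).

Let sq_lt1 (v : R) : - L < v -> v < L -> 0 < 1 - (v * L^-1) ^+ 2.
Proof.
move=> v1 v2; have : v * L^-1 < 1 by rewrite ltr_pdivrMr// mul1r.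
have : -1 < v * L^-1 by rewrite ltr_pdivlMr// mulN1r.
by move: (v * L^-1) => t t1 t2; nra.
Qed.

(** The unit disc lies over the interval |y| < 1, with horizontal sections
    |x| < sqrt (1 - y^2). Up to a shear, a graph region also has an interval as
    base and open segments as sections, and these are matched affinely. *)
Lemma graph_region_disc : planar_disc (graph_region a k h L s).
Proof.
split; first exact: open_graph_region.
exists Phi, Psi; split.
- have oO := @open_unit_disc R.
  have sc (c : R) : smooth_on (@unit_disc R) (cst c : plane R -> R).
    exact: smooth_on_cst.
  have s1 := @smooth_on_fst R _ oO; have s2 := @smooth_on_snd R _ oO.
  have sL := smooth_onM oO (sc L) s2.
  have sq : smooth_on (@unit_disc R) (fun q => (Num.sqrt (1 - q.2 ^+ 2))^-1 ^+ 1).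
    apply: (smooth_on_invsqrt oO (F := fun q => 1 - q.2 ^+ 2)).
      by move=> p; rewrite /unit_disc/= subr_gt0; apply: le_lt_trans; rewrite lerDr sqr_ge0.
    exact: (smooth_onB oO (sc 1) (smooth_onM oO s2 s2)).
  have sx := smooth_onD oO (sc a) (smooth_onM oO (smooth_onM oO (sm_width oO sL)
    (smooth_onD oO (smooth_onM oO s1 sq) (sc 1))) (sc 2^-1)).
  exact: (smooth_on_pair oO sx (smooth_onD oO sL (smooth_onM oO (sc s) sx))).
- have oO := open_graph_region.
  have sc (c : R) : smooth_on (graph_region a k h L s) (cst c : plane R -> R).
    exact: smooth_on_cst.
  have s1 := @smooth_on_fst R _ oO; have sv := sm_shear oO.
  have sq2 := smooth_onM oO sv (sc L^-1).
  have sq : smooth_on (graph_region a k h L s)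
      (fun p => Num.sqrt (1 - (shear p * L^-1) ^+ 2)).
    apply: (smooth_on_sqrt oO (F := fun p => 1 - (shear p * L^-1) ^+ 2)).
      by move=> p [p1 p2 _ _]; exact: sq_lt1.
    exact: (smooth_onB oO (sc 1) (smooth_onM oO sq2 sq2)).
  have sw := smooth_on_inv oO (fun p _ => width_gt0 _) (sm_width oO sv).
  have sx := smooth_onM oO sq (smooth_onB oO (smooth_onM oO (smooth_onM oO (sc 2)
    (smooth_onB oO s1 (sc a))) sw) (sc 1)).
  exact: (smooth_on_pair oO sx sq2).
- move=> [x t]; rewrite /unit_disc/= => xt.
  have t1 : 0 < 1 - t ^+ 2 by nra.
  pose r := Num.sqrt (1 - t ^+ 2).
  have r0 : 0 < r by rewrite sqrtr_gt0.
  have r2 : r ^+ 2 = 1 - t ^+ 2 by rewrite sqr_sqrtr// ltW.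
  have xr1 : x < r by rewrite ltNge; apply/negP => rx; nra.
  have xr2 : - r < x by rewrite ltNge; apply/negP => rx; nra.
  pose u := x * r^-1.
  have u1 : u < 1 by rewrite ltr_pdivrMr// mul1r.
  have u2 : -1 < u by rewrite ltr_pdivlMr// mulN1r.
  have vE : shear (Phi (x, t)) = L * t by rewrite /shear/=; ring.
  have PE : (Phi (x, t)).1 = a + width (L * t) * (u + 1) * 2^-1.
    by rewrite /= expr1.
  have w0 := width_gt0 (L * t).
  split.
    have t2 : t < 1 by rewrite ltNge; apply/negP => rx; nra.
    have t3 : - 1 < t by rewrite ltNge; apply/negP => rx; nra.
    rewrite /graph_region; rewrite /shear in vE; split; rewrite ?vE ?PE.
    - by rewrite -mulrN1 ltr_pM2l.
    - by rewrite -[ltRHS]mulr1 ltr_pM2l.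
    - by rewrite ltrDl divr_gt0// mulr_gt0//; lra.
    - rewrite -[ltRHS](subrKC a) -/(width (L * t)) ltrD2l.
      by rewrite ltr_pdivrMr// ltr_pM2l//; lra.
  rewrite /Psi vE PE [L * t]mulrC mulfK ?gt_eqF//; congr pair.
  rewrite -/r [t * L]mulrC.
  have -> : 2 * (a + width (L * t) * (u + 1) / 2 - a) / width (L * t) - 1 = u.
    by field; rewrite gt_eqF.
  by rewrite /u mulrCA mulfV ?mulr1// gt_eqF.
- move=> p pO; have [p1 p2 p3 p4] := pO.
  have t0 := sq_lt1 p1 p2; have w0 := width_gt0 (shear p).
  have tE : L * (shear p / L) = shear p by rewrite mulrC divfK ?gt_eqF.
  rewrite -/(shear p) in t0 p1 p2 p4.
  pose z := 2 * (p.1 - a) / width (shear p) - 1.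
  have z1 : z < 1.
    by rewrite ltrBlDr ltr_pdivrMr// /width; lra.
  have z2 : -1 < z by rewrite ltrBrDr addNr divr_gt0//; lra.
  split.
    rewrite /unit_disc/= exprMn sqr_sqrtr ?ltW// -/z.
    rewrite -ltrBrDr -[ltRHS]mulr1 ltr_pM2l//.
    by nra.
  have r0 : 0 < Num.sqrt (1 - (shear p / L) ^+ 2) by rewrite sqrtr_gt0.
  rewrite /Phi /= tE expr1 [Num.sqrt _ * _ / _]mulrAC mulfV ?gt_eqF// mul1r.
  have -> : a + width (shear p) * (2 * (p.1 - a) / width (shear p) - 1 + 1) / 2 = p.1.
    by field; rewrite gt_eqF.
  by rewrite /shear subrK; case: (p).
Qed.

End GraphRegion.

Definition rescale (R : realType) (c : plane R) (e : R) (p : plane R) : plane R :=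
  ((p.1 - c.1) * e^-1, (p.2 - c.2) * e^-1).

Lemma smooth_on_affine (R : realType) (O : set (plane R)) (a b : plane R) (r : R) :
  open O ->
  smooth_on O (fun p : plane R =>
    ((p.1 - a.1) * r + b.1, (p.2 - a.2) * r + b.2) : plane R).
Proof.
move=> oO.
have sc (c : R) : smooth_on O (cst c : plane R -> R) by exact: smooth_on_cst.
have s1 := @smooth_on_fst R _ oO; have s2 := @smooth_on_snd R _ oO.
exact: (smooth_on_pair oO
  (smooth_onD oO (smooth_onM oO (smooth_onB oO s1 (sc a.1)) (sc r)) (sc b.1))
  (smooth_onD oO (smooth_onM oO (smooth_onB oO s2 (sc a.2)) (sc r)) (sc b.2))).
Qed.

Lemma smooth_on_rescale (R : realType) (O : set (plane R)) (c : plane R) (e : R) :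
  open O -> smooth_on O (rescale c e).
Proof.
move=> oO; apply: smooth_on_ext (smooth_on_affine c 0 e^-1 oO) => //.
by move=> p _; rewrite !addr0.
Qed.

Lemma continuous_rescale (R : realType) (c : plane R) (e : R) :
  continuous (rescale c e).
Proof.
by move=> p; apply: (smooth_on_continuous openT _ I); exact: smooth_on_rescale openT.
Qed.

Lemma planar_disc_rescale (R : realType) (Omega : set (plane R)) (c : plane R) (e : R) :
  e != 0 -> planar_disc Omega -> planar_disc (rescale c e @^-1` Omega).
Proof.
move=> e0 [oO [Phi [Psi [sPhi sPsi PhiP PsiP]]]].
have oO' : open (rescale c e @^-1` Omega).
  by apply: open_comp => // p _; exact: continuous_rescale.
pose T (p : plane R) : plane R := ((p.1 - 0) * e + c.1, (p.2 - 0) * e + c.2).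
have TK p : rescale c e (T p) = p.
  by rewrite /rescale /T /= !subr0 !addrK !mulfK//; case: (p).
have KT p : T (rescale c e p) = p.
  by rewrite /rescale /T /= !subr0 !divfK// !subrK; case: (p).
split => //; exists (T \o Phi), (Psi \o rescale c e); split.
- apply: (smooth_on_comp (@open_unit_disc R) oO _ sPhi).
    by move=> q /PhiP[].
  exact: (@smooth_on_affine R Omega 0 c e oO).
- apply: (smooth_on_comp oO' oO _ _ sPsi) => //.
  exact: smooth_on_rescale.
- by move=> q /PhiP[q1 q2]; rewrite /preimage/= TK.
- by move=> p /PsiP[p1 p2]; rewrite /= p2 KT.
Qed.

(** * Transport from the plane to the surface *)

Lemma open_within_preimage (T U : topologicalType) (f : T -> U) (A : set T) (B : set U) :
  open A -> open B -> {within A, continuous f} -> open (A `&` f @^-1` B).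
Proof.
move=> oA oB; rewrite continuous_open_subspace// => cf.
rewrite openE => x [Ax Bx]; apply: filterI.
  exact: open_nbhs_nbhs (conj oA Ax).
have cfx : {for x, continuous f} by apply: cf; rewrite inE.
by apply: cfx; exact: open_nbhs_nbhs (conj oB Bx).
Qed.

Section ChartPreim.
Context (R : realType) (M : topologicalType) (c : chart R M).

Definition chart_preim (Omega : set (plane R)) : set M :=
  [set x | chart_dom c x /\ Omega (chart_map c x)].

Lemma open_chart_preim Omega : open Omega -> open (chart_preim Omega).
Proof.
move=> oO; exact: (open_within_preimage (@chart_dom_open _ _ c) oO (@chart_map_continuous _ _ c)).
Qed.

Lemma chart_preimE Omega : Omega `<=` chart_cod c -> chart_preim Omega = chart_inv c @` Omega.
Proof.
move=> Oc; apply/seteqP; split=> [x [cx Ox]|x [p Op <-]].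
  by exists (chart_map c x) => //; exact: chart_mapK.
by split; [exact/chart_inv_dom/Oc|rewrite chart_invK//; exact: Oc].
Qed.

Lemma chart_imageE (A : set M) :
  chart_map c @` (chart_dom c `&` A) = chart_cod c `&` chart_inv c @^-1` A.
Proof.
apply/seteqP; split=> [p [x [cx Ax] <-]|p [cp Ap]].
  by split; [exact: chart_map_cod|rewrite /preimage/= chart_mapK].
exists (chart_inv c p); last exact: chart_invK.
by split => //; exact: chart_inv_dom.
Qed.

Lemma open_chart_image (A : set M) : open A ->
  open (chart_map c @` (chart_dom c `&` A)).
Proof.
move=> oA; rewrite chart_imageE.
apply: (@open_within_preimage (plane R) M (chart_inv c) (chart_cod c) A) => //.
  exact: chart_cod_open.
exact: chart_inv_continuous.
Qed.

Lemma compact_chart_preim (K : set (plane R)) : K `<=` chart_cod c -> compact K ->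
  compact (chart_preim K).
Proof.
move=> Kc cK; rewrite chart_preimE//; apply: continuous_compact cK.
exact: (@continuous_subspaceW (plane R) M _ _ _ Kc (@chart_inv_continuous _ _ c)).
Qed.

Lemma connected_chart_preim (K : set (plane R)) : K `<=` chart_cod c -> connected K ->
  connected (chart_preim K).
Proof.
move=> Kc cK; rewrite chart_preimE//; apply: connected_continuous_connected cK _.
exact: (@continuous_subspaceW (plane R) M _ _ _ Kc (@chart_inv_continuous _ _ c)).
Qed.

Lemma closed_chart_preim (K : set (plane R)) : hausdorff_space M ->
  K `<=` chart_cod c -> compact K -> closed (chart_preim K).
Proof. by move=> hM Kc cK; apply: compact_closed => //; exact: compact_chart_preim. Qed.

Definition transplant (F : plane R -> R) (x : M) : R :=
  if `[< chart_dom c x >] then F (chart_map c x) else 0.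

Lemma transplantE F x : chart_dom c x -> transplant F x = F (chart_map c x).
Proof. by move=> cx; rewrite /transplant asboolT. Qed.

Lemma transplant_neq0 F (K : set (plane R)) x : (forall p, F p != 0 -> K p) ->
  transplant F x != 0 -> chart_preim K x.
Proof.
move=> FK; rewrite /transplant; case: asboolP => [cx /FK //|_]; last by rewrite eqxx.
Qed.

Lemma transplant_ge0 F x : (forall p, 0 <= F p) -> 0 <= transplant F x.
Proof. by move=> F0; rewrite /transplant; case: ifP. Qed.

Lemma support_transplant F (K Omega : set (plane R)) : hausdorff_space M ->
  compact K -> K `<=` Omega -> Omega `<=` chart_cod c -> (forall p, F p != 0 -> K p) ->
  support_of (transplant F) `<=` chart_preim Omega.
Proof.
move=> hM cK KO Oc FK x.
have Kc := subset_trans KO Oc.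
have /closure_id cl := closed_chart_preim hM Kc cK.
have /closureS H : [set x | transplant F x != 0] `<=` chart_preim K.
  by move=> y /=; exact: transplant_neq0.
by move=> /H; rewrite -cl => -[cx Kx]; split => //; exact: KO.
Qed.

End ChartPreim.

Section Disc.
Context (R : realType) (M : topologicalType) (S : smooth_surface R M) (m : nat).
Let c := atlas S m.

(** Read in another chart, the function is F composed with a transition map, or 0
    away from the image of K, which is closed because M is Hausdorff. *)
Lemma smooth_transplant (F : plane R -> R) (K : set (plane R)) :
  smooth_on (chart_cod c) F -> compact K -> K `<=` chart_cod c ->
  (forall p, F p != 0 -> K p) -> smooth_fun S (transplant c F).
Proof.
move=> sF cK Kc FK n; have hM := surface_hausdorff S.
have on := (@chart_cod_open _ _ (atlas S n)).
have cP := closed_chart_preim hM Kc cK.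
apply: smooth_on_local => // p np.
have [xc|xc] := pselect (chart_dom c (chart_inv (atlas S n) p)).
  have oU := open_chart_image (c := atlas S n) (@chart_dom_open _ _ c).
  exists (chart_map (atlas S n) @` (chart_dom (atlas S n) `&` chart_dom c)).
  split => //; first by rewrite chart_imageE.
  have H : smooth_on (chart_map (atlas S n) @` (chart_dom (atlas S n) `&` chart_dom c))
      (F \o (chart_map c \o chart_inv (atlas S n))).
    apply: (@smooth_on_comp_scalar R _ (chart_cod c) oU (@chart_cod_open _ _ c)
      (chart_map c \o chart_inv (atlas S n)) F _ _ sF).
      by move=> q; rewrite chart_imageE => -[qn qc]; exact: chart_map_cod.
    exact: atlas_smooth.
  apply: smooth_on_ext H => //.
  by move=> q; rewrite chart_imageE => -[qn qc]; rewrite /= transplantE.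
exists (chart_cod (atlas S n) `&` chart_inv (atlas S n) @^-1` (~` chart_preim c K)).
have oU : open (chart_cod (atlas S n) `&` chart_inv (atlas S n) @^-1` (~` chart_preim c K)).
  apply: open_within_preimage => //; first by rewrite openC.
  exact: chart_inv_continuous.
split => //; first by split => // -[].
apply: smooth_on_ext (smooth_on_cst oU (0 : R)) => //.
move=> q [qn qK]; apply/esym/eqP; apply: contrapT => /negP.
by move=> /(transplant_neq0 FK).
Qed.

(** Composing a chart of the atlas with a planar diffeomorphism gives a chart of the
    maximal atlas. *)
Lemma disc_chart_preim (Omega : set (plane R)) :
  planar_disc Omega -> Omega `<=` chart_cod c -> disc S (chart_preim c Omega).
Proof.
move=> [oO [Phi [Psi [sPhi sPsi PhiP PsiP]]]] Oc.
have ud := @open_unit_disc R.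
have c1 x : chart_preim c Omega x -> unit_disc ((Psi \o chart_map c) x).
  by move=> [cx /PsiP[]].
have c2 q : unit_disc q -> chart_preim c Omega ((chart_inv c \o Phi) q).
  move=> /PhiP[q1 q2]; split; first exact/chart_inv_dom/Oc.
  by rewrite /= chart_invK//; exact: Oc.
have c3 x : chart_preim c Omega x -> (chart_inv c \o Phi) ((Psi \o chart_map c) x) = x.
  by move=> [cx /PsiP[_ /= ->]]; exact: chart_mapK.
have c4 q : unit_disc q -> (Psi \o chart_map c) ((chart_inv c \o Phi) q) = q.
  by move=> /PhiP[q1 q2]; rewrite /= chart_invK//; exact: Oc.
have oP := @open_chart_preim _ _ c _ oO.
have c5 : {within chart_preim c Omega, continuous (Psi \o chart_map c)}.
  rewrite continuous_open_subspace// => x; rewrite inE => -[cx Ox].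
  apply: continuous_comp; last exact: (smooth_on_continuous oO sPsi Ox).
  have := @chart_map_continuous _ _ c.
  rewrite continuous_open_subspace; last exact: chart_dom_open.
  by apply; rewrite inE.
have c6 : {within @unit_disc R, continuous (chart_inv c \o Phi)}.
  rewrite continuous_open_subspace// => q; rewrite inE => qq.
  apply: continuous_comp; first exact: (smooth_on_continuous ud sPhi qq).
  have := @chart_inv_continuous _ _ c.
  rewrite continuous_open_subspace; last exact: chart_cod_open.
  by apply; rewrite inE; apply: Oc; have [] := PhiP q qq.
pose d := Chart oP ud c1 c2 c3 c4 c5 c6.
exists d; split => // n; split.
- have oU := open_chart_image (c := d) (@chart_dom_open _ _ (atlas S n)).
  rewrite /smooth_transition.
  apply: (@smooth_on_comp R _ (chart_map c @` (chart_dom c `&` chart_dom (atlas S n))) oU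
     _ Phi (chart_map (atlas S n) \o chart_inv c)).
  + exact/open_chart_image/chart_dom_open.
  + move=> q; rewrite !chart_imageE => -[qq qn]; split => //.
    by apply: Oc; have [] := PhiP q qq.
  + apply: (smooth_onW ud oU _ sPhi).
    by move=> q; rewrite chart_imageE => -[].
  + exact: atlas_smooth.
- have oU := open_chart_image (c := atlas S n) (@chart_dom_open _ _ d).
  apply: (@smooth_on_comp R _ Omega oU oO (chart_map c \o chart_inv (atlas S n)) Psi) => //.
  + by move=> q; rewrite chart_imageE => -[qn []].
  + apply: smooth_onW (atlas_smooth S n m) => //.
      exact/open_chart_image/chart_dom_open.
    by move=> q; rewrite !chart_imageE => -[qn []].
Qed.

End Disc.

(** * Bump functions and a locally finite cover away from a compact set *)

Definition plateau (R : realType) (A t : R) : R := step (A + 1 + t) * step (A + 1 - t).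

Section Plateau.
Context (R : realType).
Implicit Types A B t : R.

Lemma plateau_ge0 A t : 0 <= plateau A t.
Proof. by rewrite mulr_ge0 ?step_ge0. Qed.

Lemma plateau_le1 A t : plateau A t <= 1.
Proof. by rewrite mulr_ile1 ?step_ge0 ?step_le1. Qed.

Lemma plateau_in A t : - A <= t -> t <= A -> plateau A t = 1.
Proof. by move=> t1 t2; rewrite /plateau !step_ge1 ?mulr1//; lra. Qed.

Lemma plateau_out A t : plateau A t != 0 -> - (A + 1) < t /\ t < A + 1.
Proof.
move=> H; split; rewrite ltNge; apply: contra H => ?.
  by rewrite /plateau step_le0 ?mul0r//; lra.
by rewrite /plateau [X in _ * X]step_le0 ?mulr0//; lra.
Qed.

Lemma smooth_on_plateau (O : set (plane R)) (F : plane R -> R) A : open O ->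
  smooth_on O F -> smooth_on O (fun p => plateau A (F p)).
Proof.
move=> oO sF.
have sc : smooth_on O (cst (A + 1) : plane R -> R) by exact: smooth_on_cst.
exact: (smooth_onM oO (smooth_on_step oO (smooth_onD oO sc sF))
  (smooth_on_step oO (smooth_onB oO sc sF))).
Qed.

Definition mesa A B (p : plane R) : R := plateau A p.1 * plateau B p.2.

Lemma smooth_on_mesa (O : set (plane R)) A B : open O -> smooth_on O (mesa A B).
Proof.
move=> oO; exact: (smooth_onM oO (smooth_on_plateau A oO (smooth_on_fst oO))
  (smooth_on_plateau B oO (smooth_on_snd oO))).
Qed.

Lemma mesa_ge0 A B p : 0 <= mesa A B p.
Proof. by rewrite mulr_ge0 ?plateau_ge0. Qed.

Lemma mesa_le1 A B p : mesa A B p <= 1.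
Proof. by rewrite mulr_ile1 ?plateau_ge0 ?plateau_le1. Qed.

Definition rect A B : set (plane R) :=
  [set p | [/\ - A <= p.1, p.1 <= A, - B <= p.2 & p.2 <= B]].

Lemma mesa_in A B p : rect A B p -> mesa A B p = 1.
Proof. by move=> [p1 p2 p3 p4]; rewrite /mesa !plateau_in// mulr1. Qed.

Lemma mesa_out A B p : mesa A B p != 0 -> rect (A + 1) (B + 1) p.
Proof.
rewrite mulf_eq0 negb_or => /andP[/plateau_out[p1 p2] /plateau_out[p3 p4]].
by split; exact: ltW.
Qed.

Lemma compact_rect A B : compact (rect A B).
Proof.
have -> : rect A B = `[- A, A] `*` `[- B, B].
  apply/seteqP; split=> p; rewrite /= !in_itv/=.
    by move=> [-> -> -> ->].
  by move=> [/andP[? ?] /andP[? ?]].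
by apply: (@compact_setX R R); exact: segment_compact.
Qed.

Lemma compact_rescale (c : plane R) (e : R) (K : set (plane R)) :
  e != 0 -> compact K -> compact (rescale c e @^-1` K).
Proof.
move=> e0 cK.
pose T (p : plane R) : plane R := ((p.1 - 0) * e + c.1, (p.2 - 0) * e + c.2).
have -> : rescale c e @^-1` K = T @` K.
  apply/seteqP; split=> [p Kp|_ [p Kp <-]].
    exists (rescale c e p) => //.
    by rewrite /rescale /T /= !subr0 !divfK// !subrK; case: (p).
  by rewrite /preimage/= /rescale /T /= !subr0 !addrK !mulfK//; case: (p) Kp.
apply: (@continuous_compact (plane R) (plane R) T K) cK.
apply: continuous_subspaceT => p.
exact: (smooth_on_continuous openT (smooth_on_affine 0 c e openT) I).
Qed.

End Plateau.

Lemma compact_finite_cover (T : topologicalType) (A : set T) (I : choiceType)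
    (D : set I) (f : I -> set T) :
  compact A -> (forall i, D i -> open (f i)) -> A `<=` \bigcup_(i in D) f i ->
  exists F : set I, [/\ finite_set F, F `<=` D & A `<=` \bigcup_(i in F) f i].
Proof.
have [->|/set0P[x0 _] cA fo Af] := eqVneq A set0; first by exists set0; split.
pose T' : ptopologicalType := HB.pack T (isPointed.Build T x0).
have : @compact T' A by exact: cA.
rewrite compact_cover => /(_ I D f fo Af)[F FD AF].
by exists [set` F]; split => // i /FD; rewrite inE.
Qed.

Section FarCover.
Context (R : realType) (M : topologicalType) (S : smooth_surface R M).

Lemma local_bump (x : M) (O : set M) : open O -> O x ->
  exists (V : set M) (g : M -> R), [/\ disc S V, V `<=` O, smooth_fun S g,
    (forall y, 0 <= g y) /\ support_of g `<=` V & nbhs x [set y | 1 <= g y]].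
Proof.
move=> oO Ox; have [n xn] := atlas_cover S x.
pose c := atlas S n; pose p0 := chart_map c x.
have op : open (chart_cod c `&` chart_inv c @^-1` O).
  by rewrite -chart_imageE; exact: open_chart_image.
have : nbhs p0 (chart_cod c `&` chart_inv c @^-1` O).
  apply: open_nbhs_nbhs; split => //.
  by split; [exact: chart_map_cod|rewrite /preimage/= chart_mapK].
move=> /plane_nbhsP[r r0 Hr].
pose e := r / 3; have e0 : 0 < e by rewrite divr_gt0.
have eN : e != 0 by rewrite gt_eqF.
pose Omega := rescale p0 e @^-1` graph_region (-3) 0 3 3 0.
have OmegaO : Omega `<=` chart_cod c `&` chart_inv c @^-1` O.
  move=> p [] /=; rewrite !mul0r !subr0 add0r.
  rewrite ltr_pdivlMr// ltr_pdivrMr// ltr_pdivlMr// ltr_pdivrMr// /e => p1 p2 p3 p4.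
  by apply: Hr; rewrite ltr_norml; apply/andP; split; lra.
have Oc : Omega `<=` chart_cod c by move=> p /OmegaO[].
have pd a b : 0 < a -> 0 < b -> planar_disc (rescale p0 e @^-1` graph_region (- a) 0 a b 0).
  by move=> a0 b0; apply: planar_disc_rescale => //; apply: graph_region_disc => //; lra.
pose K := rescale p0 e @^-1` rect 2 2.
have cK : compact K by apply: compact_rescale => //; exact: compact_rect.
have KO : K `<=` Omega.
  by move=> p [p1 p2 p3 p4]; split; rewrite ?mul0r ?subr0 ?add0r; lra.
pose F := mesa 1 1 \o rescale p0 e.
have FK p : F p != 0 -> K p.
  by move=> /mesa_out; rewrite -[1 + 1]/(2 : R).
have sF : smooth_on (chart_cod c) F.
  apply: (smooth_on_comp_scalar (@chart_cod_open _ _ c) openT) => //.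
    by apply: smooth_on_rescale; exact: (@chart_cod_open _ _ c).
  exact: smooth_on_mesa openT.
exists (chart_preim c Omega), (transplant c F); split.
- by apply: disc_chart_preim => //; exact: pd.
- move=> y [cy Oy]; have [_] := OmegaO _ Oy; rewrite /preimage/=.
  by rewrite chart_mapK.
- exact: (@smooth_transplant _ _ S n F K sF cK (subset_trans KO Oc) FK).
- split=> [y|]; first by apply: transplant_ge0 => p; exact: mesa_ge0.
  exact: (support_transplant (surface_hausdorff S) cK KO Oc FK).
- have oP : open (chart_preim c (rescale p0 e @^-1` graph_region (- 1) 0 1 1 0)).
    by apply: open_chart_preim; have [] := pd 1 1 ltr01 ltr01.
  apply: (@filterS _ _ _ (chart_preim c (rescale p0 e @^-1` graph_region (- 1) 0 1 1 0))).
    move=> y [cy []]; rewrite !mul0r !subr0 add0r => y1 y2 y3 y4 /=.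
    by rewrite transplantE// /F/= mesa_in//; split; exact: ltW.
  apply: open_nbhs_nbhs; split => //; split => //.
  by rewrite /preimage /rescale/= /p0 !subrr !mul0r; split; rewrite /= ?mul0r; lra.
Qed.

Let E (n k : nat) : set (plane R) := rect k%:R k%:R `&`
  \bigcap_(q in ~` chart_cod (atlas S n)) [set p | k.+1%:R^-1 <= `|q - p| ].

Let compact_E n k : compact (E n k).
Proof.
apply: compact_closedI; first exact: compact_rect.
apply: closed_bigI => q _.
have -> : [set p : plane R | k.+1%:R^-1 <= `|q - p|] =
   (fun p : plane R => `|q - p|) @^-1` [set x | k.+1%:R^-1 <= x] by [].
apply: closed_comp; last exact: closed_ge.
by move=> p _; apply: cvg_norm; apply: cvgB; [exact: cvg_cst|exact: cvg_id].
Qed.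

Let E_cod n k : E n k `<=` chart_cod (atlas S n).
Proof.
move=> p [_ H]; apply: contrapT => pn.
have := H p pn; rewrite /= subrr normr0; apply/negP.
by rewrite -ltNge invr_gt0 ltr0n.
Qed.

Let E_homo n k k' : (k <= k')%N -> E n k `<=` E n k'.
Proof.
move=> kk p [[p1 p2 p3 p4] H].
have kR : k%:R <= k'%:R :> R by rewrite ler_nat.
split; first by split; lra.
move=> q /H /=; apply: le_trans.
by rewrite lef_pV2 ?posrE ?ltr0n// ler_nat.
Qed.

Let E_nbhs n p : chart_cod (atlas S n) p -> exists k, nbhs p (E n k).
Proof.
move=> np; have := open_nbhs_nbhs (conj (@chart_cod_open _ _ (atlas S n)) np).
move=> /plane_nbhsP[r r0 Hr].
have [k kE] : exists k, `|p.1| + `|p.2| + 1 + 2 / r < k%:R.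
  exists (Num.bound (`|p.1| + `|p.2| + 1 + 2 / r)).
  by rewrite archi_boundP// !addr_ge0// divr_ge0// ltW.
exists k; apply/plane_nbhsP; exists (Num.min 1 (r / 2)).
  by rewrite lt_min ltr01 divr_gt0.
move=> q; rewrite !lt_min => /andP[q1 q2] /andP[q3 q4].
have r1 : 0 < 2 / r by rewrite divr_gt0.
split.
  move: kE q1 q3 r1; move: (2 / r) k%:R => z t.
  rewrite !ltr_norml /= => ? /andP[? ?] /andP[? ?] ?.
  have := ler_norm p.1; have := ler_norm p.2.
  have := ler_norm (- p.1); have := ler_norm (- p.2); rewrite !normrN.
  by split; lra.
have kr : k.+1%:R^-1 < r / 2.
  rewrite -[r / 2]invrK ltf_pV2 ?posrE ?invr_gt0 ?divr_gt0// invf_div.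
  apply: lt_le_trans (_ : k%:R <= _); last by rewrite ler_nat.
  by apply: le_lt_trans kE; rewrite lerDr !addr_ge0.
move=> q' q'n /=; rewrite leNgt; apply/negP => qq'; apply: q'n; apply: Hr.
  rewrite -(subrKA q.1) (le_lt_trans (ler_normD _ _))// [ltRHS]splitr ltrD//.
  by apply: lt_trans kr; apply: le_lt_trans qq'; rewrite plane_normE le_max lexx.
rewrite -(subrKA q.2) (le_lt_trans (ler_normD _ _))// [ltRHS]splitr ltrD//.
by apply: lt_trans kr; apply: le_lt_trans qq'; rewrite plane_normE le_max lexx orbT.
Qed.

(** Each of the first j + 1 charts contributes the points of its codomain of norm
    at most j and at distance at least 1 / (j + 1) from the complement. *)
Lemma exhaustion : exists D : nat -> set M,
  [/\ forall n, compact (D n), forall i j, (i <= j)%N -> D i `<=` D j &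
      forall x : M, exists n, nbhs x (D n)].
Proof.
exists (fun j => \big[setU/set0]_(n < j.+1) chart_preim (atlas S n) (E n j)); split.
- move=> n; apply: bigsetU_compact => i _.
  by apply: compact_chart_preim; [exact: E_cod|exact: compact_E].
- move=> i j ij x; rewrite -!(bigcup_mkord _ (fun n => chart_preim (atlas S n) (E n _))).
  move=> [n /= ni [xn xE]]; exists n => /=; first exact: leq_trans ni _.
  by split => //; exact: E_homo xE.
- move=> x; have [n xn] := atlas_cover S x.
  have [k kE] := E_nbhs (chart_map_cod xn).
  exists (maxn n k).
  have oI : open (chart_preim (atlas S n) (E n k)°).
    by apply: open_chart_preim; exact: open_interior.
  apply: (@filterS _ _ _ (chart_preim (atlas S n) (E n k)°)).
    move=> y [yn /interior_subset yE].
    rewrite -(bigcup_mkord _ (fun n0 => chart_preim (atlas S n0) (E n0 _))).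
    exists n => /=; first by rewrite ltnS leq_maxl.
    by split => //; apply: E_homo yE; exact: leq_maxr.
  by apply: open_nbhs_nbhs; split.
Qed.

(** The points of D j which lie neither in W nor in the interior of an earlier D i
    form a compact set L j, covered by finitely many small discs. These are chosen
    to avoid K and each D k, k < j, which is covered by the interiors of the D i
    for i < j. A given D k is covered after finitely many stages, so it meets only
    finitely many of the discs. *)
Lemma far_cover (K W : set M) : closed K -> open W -> K `<=` W ->
  exists (A : set (nat * M)) (V : nat * M -> set M) (g : nat * M -> M -> R),
  [/\ forall j, A j -> [/\ disc S (V j), V j `&` K = set0, smooth_fun S (g j),
        forall y, 0 <= g j y & support_of (g j) `<=` V j],
      forall x : M, exists2 N, nbhs x N & finite_set [set j | A j /\ V j `&` N !=set0] &
      forall x, ~ W x -> exists2 j, A j & 1 <= g j x].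
Proof.
move=> cK oW KW.
have hM := surface_hausdorff S.
have [D [cD Dhomo Dnbhs]] := exhaustion.
pose B j := \bigcup_(i in [set i | (i < j)%N]) (D i)°.
pose far j : set nat := [set k | (k < j)%N /\ D k `<=` B j].
pose O j := ~` K `&` ~` (\bigcup_(k in far j) D k).
pose L j := D j `&` ~` (B j `|` W).
have oB j : open (B j) by apply: bigcup_open => i _; exact: open_interior.
have oO j : open (O j).
  apply: openI; rewrite openC//; apply: closed_bigcup; last first.
    by move=> i _; exact: compact_closed.
  by apply: sub_finite_set (finite_II j) => k [].
have LO j : L j `<=` O j.
  move=> x [xD xBW]; split.
    by move=> xK; apply: xBW; right; exact: KW.
  by move=> [k [kj kB] /kB xB]; apply: xBW; left.
have cL j : compact (L j).
  apply: compact_closedI => //; rewrite closedC; exact: openU.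
have : forall jx : nat * M, exists Vg : set M * (M -> R), L jx.1 jx.2 ->
   [/\ disc S Vg.1, Vg.1 `<=` O jx.1, smooth_fun S Vg.2,
    (forall y, 0 <= Vg.2 y) /\ support_of Vg.2 `<=` Vg.1 &
    nbhs jx.2 [set y | 1 <= Vg.2 y]].
  move=> [j x]; have [Lx|] := pselect (L j x); last by exists (set0, cst 0).
  by have [V [g H]] := local_bump (oO j) (LO _ _ Lx); exists (V, g).
move=> /choice[Vg VgP].
have : forall j, exists T : set M, [/\ finite_set T, T `<=` L j &
    L j `<=` \bigcup_(x in T) [set y | 1 <= (Vg (j, x)).2 y]°].
  move=> j; apply: compact_finite_cover => //.
    by move=> x _; exact: open_interior.
  by move=> x Lx; exists x => //; have [_ _ _ _] := VgP (j, x) Lx.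
move=> /choice[T TP].
exists [set jx | T jx.1 jx.2], (fun jx => (Vg jx).1), (fun jx => (Vg jx).2).
split.
- move=> [j x] /= Tx; have [_ /(_ _ Tx) Lx _] := TP j; have [V1 V2 V3 [V4 V5] _] := VgP (j, x) Lx.
  split => //; apply/seteqP; split => // y [/V2[yK _] yK'].
  exact: (yK yK').
- move=> x; have [k xk] := Dnbhs x.
  have [m km] : exists m, D k `<=` B m.
    have [|y _|F [finF _ DF]] := @compact_finite_cover _ (D k) nat setT (fun i => (D i)°) (@cD k).
    + by move=> i _; exact: open_interior.
    + by have [i yi] := Dnbhs y; exists i.
    + have [m Fm] : exists m, forall i, F i -> (i < m)%N.
        exists (\max_(i <- fset_set F) i).+1 => i Fi; rewrite ltnS.
        by apply: leq_bigmax_seq => //; rewrite in_fset_set// inE.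
      by exists m => y /DF [i /= iF yi]; exists i => //=; exact: Fm.
  exists (D k) => //.
  pose J := maxn m k.+1.
  apply: (@sub_finite_set _ _ (\bigcup_(j in `I_J) [set (j, x) | x in T j])).
    move=> [j z] [/= zT [y [yV yD]]]; exists j => //=.
      rewrite ltnNge; apply/negP; rewrite geq_max => /andP[mj kj].
      have [_ TL _] := TP j; have [_ + _ _ _] := VgP (j, z) (TL _ zT).
      move=> /(_ _ yV) [_]; apply; exists k => //; split => //.
      apply: (subset_trans km) => t [i im ti]; exists i => //=.
      exact: leq_trans im mj.
    by exists z.
  apply: bigcup_finite; first exact: finite_II.
  move=> j _; by apply: finite_image; have [] := TP j.
- move=> x xW.
  have ex : exists n, `[< nbhs x (D n) >].
    by have [n xn] := Dnbhs x; exists n; apply/asboolP.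
  case: (ex_minnP ex) => j /asboolP xj jmin.
  have Lx : L j x.
    split; first exact: nbhs_singleton.
    move=> [[i ij xi]|//]; have /jmin : `[< nbhs x (D i) >] by apply/asboolP.
    by rewrite leqNgt ij.
  have [_ _ /(_ x Lx)[y /= yT]] := TP j.
  by move=> /interior_subset /= H; exists (j, y).
Qed.

End FarCover.

(** * The planar model *)

Definition dplateau (R : realType) (A t : R) : R :=
  dstep (A + 1 + t) * step (A + 1 - t) - step (A + 1 + t) * dstep (A + 1 - t).

Lemma is_derive_mirror (R : realType) (s ds : R -> R) (a t : R) :
  (forall x : R, is_derive x 1 s (ds x)) ->
  is_derive t 1 (fun t => s (a + t) * s (a - t))
    (ds (a + t) * s (a - t) - s (a + t) * ds (a - t)).
Proof.
move=> dsP.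
have dD : is_derive t 1 (cst a + id : R -> R) 1.
  by apply: is_derive_eq; rewrite add0r.
have dB : is_derive t 1 (cst a - id : R -> R) (- 1).
  by apply: is_derive_eq; rewrite sub0r.
have d1 := is_derive1_comp (dsP ((cst a + id) t)) dD.
have d2 := is_derive1_comp (dsP ((cst a - id) t)) dB.
have -> : (fun t => s (a + t) * s (a - t)) =
  (s \o (cst a + id)) * (s \o (cst a - id)) by [].
apply: is_derive_eq.
by rewrite /GRing.scale/= !fctE; ring.
Qed.

Lemma is_derive_plateau (R : realType) (A t : R) :
  is_derive t 1 (@plateau R A) (dplateau A t).
Proof. exact: (is_derive_mirror (A + 1) t (@is_derive_step R)). Qed.

Lemma dplateau_bound (R : realType) (A t : R) :
  `|dplateau A t| <= dstep (A + 1 + t) + dstep (A + 1 - t).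
Proof.
have aux (a b : R) : 0 <= a -> 0 <= b -> b <= 1 -> `|a * b| <= a.
  by move=> a0 b0 b1; rewrite ger0_norm ?mulr_ge0// ler_piMr.
apply: le_trans (ler_normB _ _) _; apply: lerD.
  by apply: aux; [exact: dstep_ge0|exact: step_ge0|exact: step_le1].
by rewrite mulrC; apply: aux; [exact: dstep_ge0|exact: step_ge0|exact: step_le1].
Qed.

Lemma mul4_neq0 (R : realType) (a b c d : R) :
  a * b * c * d != 0 -> a != 0 /\ b != 0 /\ c != 0.
Proof. by rewrite !mulf_eq0 !negb_or => /andP[/andP[/andP[-> ->] ->] _]. Qed.

Section Model.
#[local] Opaque step dstep plateau mesa.

Context (R : realType) (n : nat).
Hypothesis n0 : (0 < n)%N.

Let nR : 1 <= n%:R :> R. Proof. by rewrite ler1n. Qed.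

Let Y : R := 3 * n%:R + 1.

(** The function f1 of the model. It equals 1 on |x| <= 1, |y| <= 3 n + 1 and depends
    on x only as long as |y| <= 3 n + 1. *)
Definition hill : plane R -> R := mesa 1 Y.

(** A bump around the ray y = i x, for x > 0, to the right of the centre. All the
    rays with 0 <= i <= n stay in |y| <= 3 n + 1 for x <= 3. *)
Definition slit (i : nat) (q : plane R) : R :=
  step q.1 * plateau 1 (4 * (q.2 - i%:R * q.1)).

Definition shore (i : nat) (q : plane R) : R :=
  (1 - hill q) * (1 - slit i q) * mesa 4 (Y + 3) q * n%:R^-1.

Lemma slit_le1 i q : slit i q <= 1.
Proof. by rewrite mulr_ile1 ?step_ge0 ?plateau_ge0 ?step_le1 ?plateau_le1. Qed.

Lemma shore_ge0 i q : 0 <= shore i q.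
Proof.
apply: mulr_ge0; last by rewrite invr_ge0 ler0n.
apply: mulr_ge0; last exact: mesa_ge0.
by apply: mulr_ge0; rewrite subr_ge0; [exact: mesa_le1|exact: slit_le1].
Qed.

Lemma smooth_on_slit O i : open O -> smooth_on O (slit i).
Proof.
move=> oO.
have sc (c : R) : smooth_on O (cst c : plane R -> R) by exact: smooth_on_cst.
have s1 := smooth_on_fst oO; have s2 := smooth_on_snd oO.
exact: (smooth_onM oO (smooth_on_step oO s1) (smooth_on_plateau 1 oO
  (smooth_onM oO (sc 4) (smooth_onB oO s2 (smooth_onM oO (sc i%:R) s1))))).
Qed.

Lemma smooth_on_hill O : open O -> smooth_on O hill.
Proof. exact: smooth_on_mesa. Qed.

Lemma smooth_on_shore O i : open O -> smooth_on O (shore i).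
Proof.
move=> oO.
have sc (c : R) : smooth_on O (cst c : plane R -> R) by exact: smooth_on_cst.
exact: (smooth_onM oO (smooth_onM oO (smooth_onM oO
  (smooth_onB oO (sc 1) (smooth_on_hill oO))
  (smooth_onB oO (sc 1) (smooth_on_slit i oO)))
  (smooth_on_mesa 4 (Y + 3) oO)) (sc n%:R^-1)).
Qed.

Definition slit_width : R := Y + 5 + 5 * n%:R.

Definition hill_disc : set (plane R) := graph_region (-3) 0 3 (Y + 2) 0.

(** What remains of a slanted strip outside a thin parabola around the ray y = i x,
    with vertex at the centre. *)
Definition shore_disc (i : nat) : set (plane R) :=
  graph_region (-6) 96 0 slit_width i%:R.

Definition shore_support (i : nat) : set (plane R) :=
  rect 5 (Y + 4) `&` [set q | q.1 <= -1 \/ 1 / 4 <= `|q.2 - i%:R * q.1|].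

(** Where the hill is not 1 the point lies outside |x| <= 1, |y| <= 3 n + 1. Above
    and below this rectangle all the rays are far away; to the right of it the
    factor 1 - slit vanishes on the middle of the slit. *)
Lemma shore_supportP i q : (i <= n)%N -> shore i q != 0 -> shore_support i q.
Proof.
move=> ni H.
have [h1 [s1 b1]] := mul4_neq0 H.
split; first by have [] := mesa_out b1; split; lra.
have iR : i%:R <= n%:R :> R by rewrite ler_nat.
have i0 : 0 <= i%:R :> R by rewrite ler0n.
rewrite /=; have [x1|x1] := leP q.1 (-1); [by left|right].
rewrite leNgt; apply/negP; rewrite ltr_norml => /andP[v1 v2].
have [x2|x2] := leP q.1 1.
  move: h1; rewrite subr_eq0 eq_sym => /negP; apply; apply/eqP.
  apply: mesa_in; rewrite /Y; split; [lra|lra|nra|nra].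
move: s1; rewrite subr_eq0 eq_sym => /negP; apply; apply/eqP.
by rewrite /slit step_ge1 ?(ltW x2)// plateau_in ?mulr1//; lra.
Qed.

Lemma compact_shore_support i : compact (shore_support i).
Proof.
apply: compact_closedI; first exact: compact_rect.
have oT : open [set: plane R] := openT.
have -> : [set q : plane R | q.1 <= -1 \/ 1 / 4 <= `|q.2 - i%:R * q.1|] =
   (fst @^-1` [set x : R | x <= -1]) `|`
   ((fun q : plane R => `|q.2 - i%:R * q.1|) @^-1` [set x : R | 1 / 4 <= x]) by [].
apply: closedU; apply: closed_comp.
- by move=> q _; exact: cvg_fst.
- exact: closed_le.
- move=> q _; apply: cvg_norm; apply: cvgB; first exact: cvg_snd.
  by apply: cvgM; [exact: cvg_cst|exact: cvg_fst].
- exact: closed_ge.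
Qed.

(** On the support, either x is negative or y - i x is bounded below in absolute
    value, and then 96 (y - i x)^2 >= 6 exceeds x. *)
Lemma shore_support_sub i : (i <= n)%N -> shore_support i `<=` shore_disc i.
Proof.
move=> ni [x y] [[/= x1 x2 y1 y2] H].
have iR : i%:R <= n%:R :> R by rewrite ler_nat.
have i0 : 0 <= i%:R :> R by rewrite ler0n.
have ix1 : i%:R * x <= 5 * n%:R by nra.
have ix2 : - (5 * n%:R) <= i%:R * x by nra.
rewrite /shore_disc /graph_region /slit_width /=; split; [lra|lra|lra|].
rewrite addr0; case: H => [x3|].
  have : 0 <= (y - i%:R * x) ^+ 2 by rewrite sqr_ge0.
  by lra.
rewrite -[in _ < _](real_normK (num_real _)).
by move: `|_| => v v1; nra.
Qed.

(** The centre is the vertex of all the parabolas. This makes the domain of the hill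
    essential. *)
Lemma shore_disc0 i : ~ shore_disc i (0, 0).
Proof. by move=> [_ _ _ /=]; rewrite mulr0 subr0 expr0n mulr0 addr0 ltxx. Qed.

(** The i-th ray crosses the right side of [hill_disc] at this point. This makes the
    domain of the hill confined. *)
Lemma shore_disc3 i : ~ shore_disc i (3, i%:R * 3).
Proof. by move=> [_ _ _ /=]; rewrite subrr expr0n mulr0 addr0; lra. Qed.

Lemma slit_neq0 i q : slit i q != 0 ->
  0 < q.1 /\ (- 2 < 4 * (q.2 - i%:R * q.1) /\ 4 * (q.2 - i%:R * q.1) < 2).
Proof.
move=> H; have s0 : step q.1 != 0 by apply: contra_neq H => h; rewrite /slit h mul0r.
have p0 : plateau 1 (4 * (q.2 - i%:R * q.1)) != 0.
  by apply: contra_neq H => h; rewrite /slit h mulr0.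
split; first by rewrite ltNge; apply: contra s0 => /step_le0 ->.
by have [] := plateau_out p0; split; lra.
Qed.

Lemma slit_disjoint i j q : slit i q != 0 -> slit j q != 0 -> 1 <= q.1 -> i = j.
Proof.
move=> /slit_neq0[_ [a1 a2]] /slit_neq0[_ [b1 b2]] x1.
have aux (k l : nat) : (k < l)%N -> q.1 <= l%:R * q.1 - k%:R * q.1.
  move=> kl; rewrite -mulrBl -[leLHS]mul1r ler_wpM2r ?(le_trans ler01)//.
  by rewrite lerBrDr addrC natr1 ler_nat.
by case: (ltngtP i j) => // /aux H; clear aux; exfalso; lra.
Qed.

(** Two slits overlap only close to the centre, where the hill has height 1. *)
Lemma sum_slit_le1 q : hill q = 1 \/ \sum_(i < n.+1) slit i q <= 1.
Proof.
have [[i si]|H] := pselect (exists i : 'I_n.+1, slit i q != 0); last first.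
  right; rewrite big1// => i _; apply: contrapT => /eqP si; apply: H.
  by exists i.
have [x1|x1] := leP 1 q.1.
  right; rewrite (bigD1 i)//= big1 ?addr0 ?slit_le1// => j ji.
  apply: contrapT => /eqP sj; move/eqP: ji; apply.
  by apply: val_inj; exact: slit_disjoint sj si x1.
left; have [x0 [a1 a2]] := slit_neq0 si.
have iR : i%:R <= n%:R :> R by rewrite ler_nat -ltnS.
have i0 : 0 <= i%:R :> R by rewrite ler0n.
have ix : i%:R * q.1 <= n%:R by nra.
have ix0 : 0 <= i%:R * q.1 by rewrite mulr_ge0// ltW.
by apply: mesa_in; rewrite /Y; split; lra.
Qed.

(** With at most one slit at each point, n of the n + 1 shores are present there,
    each with weight (1 - hill) / n. *)
Lemma hill_shore_ge1 q : rect 4 (Y + 3) q ->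
  1 <= hill q + \sum_(i < n.+1) shore i q.
Proof.
move=> qr; under eq_bigr do rewrite /shore mesa_in// mulr1.
have [->|s1] := sum_slit_le1 q.
  by rewrite big1 ?addr0// => i _; rewrite subrr !mul0r.
rewrite -mulr_suml -mulr_sumr sumrB sumr_const card_ord.
have h1 : 0 <= 1 - hill q by rewrite subr_ge0 mesa_le1.
rewrite -lerBlDl ler_pdivlMr ?(lt_le_trans ltr01)// ler_wpM2l// -natr1.
by lra.
Qed.

End Model.

Lemma model_bounded (R : realType) (n : nat) : exists2 B : R, 0 < B &
  (forall q, rect 5 (3 * n%:R + 1 + 4) q -> `|q.1| < B /\ `|q.2| < B) /\
  forall i q, (i <= n)%N -> shore_disc n i q -> `|q.1| < B /\ `|q.2| < B.
Proof.
pose L := slit_width R n.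
have nR : 0 <= n%:R :> R by [].
have L0 : 6 <= L by rewrite /L /slit_width; lra.
pose B := 96 * L ^+ 2 * (n%:R + 1) + L.
have LL : 6 * L <= L ^+ 2 by rewrite expr2 ler_wpM2r//; lra.
have L2 : L <= B by rewrite /B lerDr mulr_ge0// ?addr_ge0// mulr_ge0// sqr_ge0.
have L3 : 96 * L ^+ 2 + L <= B.
  rewrite /B lerD2r mulrDr mulr1 lerDr; apply: mulr_ge0 => //.
  by apply: mulr_ge0 => //; exact: sqr_ge0.
exists B; first by lra.
split.
  move=> q [q1 q2 q3 q4]; rewrite !ltr_norml.
  have : 3 * n%:R + 5 < L by rewrite /L /slit_width; lra.
  by move=> ?; split; apply/andP; split; lra.
move=> i [x y] ni [/=]; rewrite -/L addr0 => v1 v2 x1 x2.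
have iR : i%:R <= n%:R :> R by rewrite ler_nat.
have i0 : 0 <= i%:R :> R by rewrite ler0n.
have vL : (y - i%:R * x) ^+ 2 < L ^+ 2 by nra.
have x3 : x < 96 * L ^+ 2 by lra.
have x4 : - (96 * L ^+ 2) < x by lra.
have ix1 : i%:R * x <= n%:R * (96 * L ^+ 2) by nra.
have ix2 : - (n%:R * (96 * L ^+ 2)) <= i%:R * x by nra.
have BE : B = n%:R * (96 * L ^+ 2) + 96 * L ^+ 2 + L by rewrite /B; ring.
rewrite !ltr_norml BE; split; apply/andP; split; nra.
Qed.

(** * The Jacobian determinants of the model *)

Definition jac (R : realType) (F G : plane R -> R) (q : plane R) : R :=
  'D_(1, 0) F q * 'D_(0, 1) G q - 'D_(0, 1) F q * 'D_(1, 0) G q.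

Lemma partial_fst (R : realType) (F : plane R -> R) (q : plane R) (d : R) :
  smooth_on [set: plane R] F ->
  is_derive q.1 1 (fun t => F (t, q.2)) d -> 'D_(1, 0) F q = d.
Proof.
move=> sF dF; have dq : derivable F (q.1, q.2) (1, 0).
  exact: (smooth_on_derivable sF).
have [_ E1] := derive_fst dq; have [_ E2] := dF.
by rewrite -E2 E1; case: (q).
Qed.

Lemma partial_snd (R : realType) (F : plane R -> R) (q : plane R) (d : R) :
  smooth_on [set: plane R] F ->
  is_derive q.2 1 (fun t => F (q.1, t)) d -> 'D_(0, 1) F q = d.
Proof.
move=> sF dF; have dq : derivable F (q.1, q.2) (0, 1).
  exact: (smooth_on_derivable sF).
have [_ E1] := derive_snd dq; have [_ E2] := dF.
by rewrite -E2 E1; case: (q).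
Qed.

Lemma is_derive_compl_prod (R : realType) (a b : R -> R) (da db k x : R) :
  is_derive x 1 a da -> is_derive x 1 b db ->
  is_derive x 1 (fun t => (1 - a t) * (1 - b t) * k)
    (- (da * (1 - b x) + (1 - a x) * db) * k).
Proof.
move=> ha hb.
have -> : (fun t => (1 - a t) * (1 - b t) * k) = (cst 1 - a) * (cst 1 - b) * cst k by [].
by apply: is_derive_eq; rewrite /GRing.scale/= ?fctE; ring.
Qed.

Lemma is_derive_slanted_x (R : realType) (s ds p dp : R -> R) (y k x : R) :
  (forall x : R, is_derive x 1 s (ds x)) -> (forall x : R, is_derive x 1 p (dp x)) ->
  is_derive x 1 (fun t => s t * p (4 * (y - k * t)))
    (ds x * p (4 * (y - k * x)) - s x * dp (4 * (y - k * x)) * (4 * k)).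
Proof.
move=> hs hp.
have dl : is_derive x 1 (cst 4 * (cst y - cst k * id) : R -> R) (- (4 * k)).
  by apply: is_derive_eq; rewrite /GRing.scale/= ?fctE; ring.
have d1 := is_derive1_comp (hp ((cst 4 * (cst y - cst k * id)) x)) dl.
have hsx := hs x.
have -> : (fun t => s t * p (4 * (y - k * t))) =
  s * (p \o (cst 4 * (cst y - cst k * id))) by [].
by apply: is_derive_eq; rewrite /GRing.scale/= ?fctE; ring.
Qed.

Lemma is_derive_slanted_y (R : realType) (p dp : R -> R) (c k y : R) :
  (forall x : R, is_derive x 1 p (dp x)) ->
  is_derive y 1 (fun t => c * p (4 * (t - k))) (c * dp (4 * (y - k)) * 4).
Proof.
move=> hp.
have dl : is_derive y 1 (cst 4 * (id - cst k) : R -> R) 4.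
  by apply: is_derive_eq; rewrite /GRing.scale/= ?fctE; ring.
have d1 := is_derive1_comp (hp ((cst 4 * (id - cst k)) y)) dl.
have -> : (fun t => c * p (4 * (t - k))) =
  cst c * (p \o (cst 4 * (id - cst k))) by [].
by apply: is_derive_eq; rewrite /GRing.scale/= ?fctE; ring.
Qed.

Lemma is_derive_cmul (R : realType) (f : R -> R) (df c x : R) :
  is_derive x 1 f df -> is_derive x 1 (fun t => c * f t) (c * df).
Proof.
move=> h; have -> : (fun t => c * f t) = cst c * f by [].
by apply: is_derive_eq; rewrite /GRing.scale/= ?fctE; ring.
Qed.

Lemma is_derive_mulc (R : realType) (f : R -> R) (df c x : R) :
  is_derive x 1 f df -> is_derive x 1 (fun t => f t * c) (df * c).
Proof.
move=> h; have -> : (fun t => f t * c) = f * cst c by [].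
by apply: is_derive_eq; rewrite /GRing.scale/= ?fctE; ring.
Qed.

Lemma jac_compl_prod (R : realType) (h1 h2 h s s1 s2 k : R) :
  - (h1 * (1 - s) + (1 - h) * s1) * k * h2 -
  - (h2 * (1 - s) + (1 - h) * s2) * k * h1 =
  k * ((1 - h) * (s2 * h1 - s1 * h2)).
Proof. by ring. Qed.

Section Jacobian.
Context (R : realType) (n : nat).
Hypothesis n0 : (0 < n)%N.

Let Y : R := 3 * n%:R + 1.

Let D1hill q : 'D_(1, 0) (@hill R n) q = dplateau 1 q.1 * plateau Y q.2.
Proof.
apply: partial_fst; first exact/smooth_on_hill/openT.
exact: (is_derive_mulc (plateau Y q.2) (is_derive_plateau 1 q.1)).
Qed.

Let D2hill q : 'D_(0, 1) (@hill R n) q = plateau 1 q.1 * dplateau Y q.2.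
Proof.
apply: partial_snd; first exact/smooth_on_hill/openT.
exact: (is_derive_cmul (plateau 1 q.1) (is_derive_plateau Y q.2)).
Qed.

Let G i (q : plane R) := (1 - hill n q) * (1 - slit i q) * n%:R^-1.

Let sG i : smooth_on [set: plane R] (G i).
Proof.
have oT : open [set: plane R] := openT.
have sc (c : R) : smooth_on [set: plane R] (cst c : plane R -> R) by exact: smooth_on_cst.
exact: (smooth_onM oT (smooth_onM oT (smooth_onB oT (sc 1) (smooth_on_hill n oT))
  (smooth_onB oT (sc 1) (smooth_on_slit i oT))) (sc n%:R^-1)).
Qed.

Let D1slit i (q : plane R) : R :=
  dstep q.1 * plateau 1 (4 * (q.2 - i%:R * q.1)) -
  step q.1 * dplateau 1 (4 * (q.2 - i%:R * q.1)) * (4 * i%:R).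

Let D2slit i (q : plane R) : R :=
  step q.1 * dplateau 1 (4 * (q.2 - i%:R * q.1)) * 4.

Let D1G i q : 'D_(1, 0) (G i) q =
  - (dplateau 1 q.1 * plateau Y q.2 * (1 - slit i q) +
     (1 - hill n q) * D1slit i q) * n%:R^-1.
Proof.
apply: partial_fst; first exact: sG.
case: q => x y.
have h1 : is_derive x 1 (fun t : R => hill n (t, y)) (dplateau 1 x * plateau Y y).
  exact: (is_derive_mulc (plateau Y y) (is_derive_plateau 1 x)).
have h2 : is_derive x 1 (fun t : R => slit i (t, y)) (D1slit i (x, y)).
  exact: (is_derive_slanted_x y i%:R x (@is_derive_step R) (@is_derive_plateau R 1)).
exact: (is_derive_compl_prod n%:R^-1 h1 h2).
Qed.

Let D2G i q : 'D_(0, 1) (G i) q =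
  - (plateau 1 q.1 * dplateau Y q.2 * (1 - slit i q) +
     (1 - hill n q) * D2slit i q) * n%:R^-1.
Proof.
apply: partial_snd; first exact: sG.
case: q => x y.
have h1 : is_derive y 1 (fun t : R => hill n (x, t)) (plateau 1 x * dplateau Y y).
  exact: (is_derive_cmul (plateau 1 x) (is_derive_plateau Y y)).
have h2 : is_derive y 1 (fun t : R => slit i (x, t)) (D2slit i (x, y)).
  exact: (is_derive_slanted_y (step x) (i%:R * x) y (@is_derive_plateau R 1)).
exact: (is_derive_compl_prod n%:R^-1 h1 h2).
Qed.

Let shore_near i q : hill_disc n q -> \forall p \near q, shore n i p = G i p.
Proof.
move=> qD; have oD : open (@hill_disc R n).
  by apply: open_graph_region.
apply: filterS (open_nbhs_nbhs (conj oD qD)) => p [] /=.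
rewrite !mul0r !subr0 add0r -/Y => p1 p2 p3 p4.
by rewrite /shore mesa_in ?mulr1//; split; rewrite -/Y; lra.
Qed.

Definition jac_bound (i : nat) (q : plane R) : R :=
  n%:R^-1 * ((1 - step (1 + 1 - q.1)) * dstep (1 + 1 - q.1)) *
  (4 * (dstep (1 + 1 + 4 * (q.2 - i%:R * q.1)) +
        dstep (1 + 1 - 4 * (q.2 - i%:R * q.1)))).

Lemma jac_bound_ge0 i q : 0 <= jac_bound i q.
Proof.
rewrite /jac_bound; apply: mulr_ge0.
  apply: mulr_ge0; first by rewrite invr_ge0 ler0n.
  by apply: mulr_ge0; [rewrite subr_ge0 step_le1|exact: dstep_ge0].
by apply: mulr_ge0 => //; apply: addr_ge0; exact: dstep_ge0.
Qed.

(** Along a slit the hill depends on x only, so the Jacobian determinant reduces to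
    its x-derivative times the y-derivative of the shore. Outside the i-th slit,
    shore i is a function of the hill and the determinant vanishes. *)
Lemma jac_shore_hill i q : (i <= n)%N -> hill_disc n q ->
  `|jac (shore n i) (hill n) q| <= jac_bound i q.
Proof.
move=> ni qD; rewrite /jac !(near_eq_derive _ (shore_near i qD)) D1G D2G D1hill D2hill.
have nR : 1 <= n%:R :> R by rewrite ler1n.
have iR : i%:R <= n%:R :> R by rewrite ler_nat.
have i0 : 0 <= i%:R :> R by rewrite ler0n.
rewrite jac_compl_prod.
have [p1 p2 p3 p4] := qD.
rewrite !mul0r !subr0 add0r -/Y in p1 p2 p3 p4.
have [x0|x0] := leP q.1 0.
  rewrite /D1slit /D2slit step_le0// dstep_le0// !(mul0r, subrr, mulr0) normr0.
  exact: jac_bound_ge0.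
pose v := 4 * (q.2 - i%:R * q.1).
have vout : plateau 1 v = 0 -> dplateau 1 v = 0 -> D1slit i q = 0 /\ D2slit i q = 0.
  by rewrite /D1slit /D2slit -/v => -> ->; rewrite !(mul0r, mulr0, subrr).
have v0 : D1slit i q = 0 /\ D2slit i q = 0 ->
  `|n%:R^-1 * ((1 - hill n q) * (D2slit i q * (dplateau 1 q.1 * plateau Y q.2) -
     D1slit i q * (plateau 1 q.1 * dplateau Y q.2)))| <= jac_bound i q.
  by move=> [-> ->]; rewrite !mul0r subrr !mulr0 normr0 jac_bound_ge0.
have [v1|v1] := leP v (- (1 + 1)).
  apply/v0/vout.
    have w : 1 + 1 + v <= 0 by lra.
    by rewrite /plateau (step_le0 w) mul0r.
  have w : 1 + 1 + v <= 0 by lra.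
  by rewrite /dplateau (step_le0 w) (dstep_le0 w) !mul0r subrr.
have [v2|v2] := leP (1 + 1) v.
  apply/v0/vout.
    have w : 1 + 1 - v <= 0 by lra.
    by rewrite /plateau (step_le0 w) mulr0.
  have w : 1 + 1 - v <= 0 by lra.
  by rewrite /dplateau (step_le0 w) (dstep_le0 w) !mulr0 subrr.
have ix : i%:R * q.1 <= 3 * n%:R by nra.
have ix0 : 0 <= i%:R * q.1 by rewrite mulr_ge0// ltW.
have y1 : - Y <= q.2 by rewrite /v in v1; rewrite /Y; lra.
have y2 : q.2 <= Y by rewrite /v in v2; rewrite /Y; lra.
have pY : plateau Y q.2 = 1 by rewrite plateau_in.
have dY : dplateau Y q.2 = 0.
  have w1 : 1 <= Y + 1 + q.2 by rewrite addrAC lerDr -lerBlDl sub0r.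
  have w2 : 1 <= Y + 1 - q.2 by rewrite addrAC lerDr subr_ge0.
  by rewrite /dplateau (dstep_ge1 w1) (dstep_ge1 w2) mulr0 mul0r subrr.
have xw : 1 <= 1 + 1 + q.1 by rewrite -addrA lerDl addr_ge0// ltW.
have px : plateau 1 q.1 = step (1 + 1 - q.1).
  by rewrite /plateau (step_ge1 xw) mul1r.
have dx : dplateau 1 q.1 = - dstep (1 + 1 - q.1).
  by rewrite /dplateau (step_ge1 xw) (dstep_ge1 xw) mul1r mul0r sub0r.
have hq : hill n q = step (1 + 1 - q.1) by rewrite -px /hill /mesa -/Y pY mulr1.
rewrite hq pY dY dx !mulr0 subr0 mulr1 /D2slit /jac_bound -/v.
have s1 : 0 <= 1 - step (1 + 1 - q.1) by rewrite subr_ge0 step_le1.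
have n1 : 0 <= n%:R^-1 :> R by rewrite invr_ge0 ler0n.
have d1 := dstep_ge0 (1 + 1 - q.1); have d2 := step_ge0 q.1.
rewrite !normrM normrN (ger0_norm n1) (ger0_norm s1) (ger0_norm d1) (ger0_norm d2).
rewrite -[leRHS]mulrA ler_wpM2l// -[leRHS]mulrA ler_wpM2l// mulrC ler_wpM2l//.
rewrite (ger0_norm (ler0n R 4)) mulrC ler_wpM2l//.
apply: le_trans (dplateau_bound 1 v).
by rewrite ler_piMl// step_le1.
Qed.

End Jacobian.

Lemma jac_near (R : realType) (F F' G G' : plane R -> R) (p : plane R) :
  (\forall q \near p, F q = F' q) -> (\forall q \near p, G q = G' q) ->
  jac F G p = jac F' G' p.
Proof. by move=> FF GG; rewrite /jac !(near_eq_derive _ FF) !(near_eq_derive _ GG). Qed.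

Lemma jac_near0 (R : realType) (F G : plane R -> R) (p : plane R) :
  (\forall q \near p, F q = cst 0 q) -> jac F G p = 0.
Proof.
by move=> F0; rewrite /jac !(near_eq_derive _ F0) !derive_cst !mul0r subrr.
Qed.

Lemma derive_rescale_fst (R : realType) (F : plane R -> R) (c p : plane R) (e : R) :
  smooth_on [set: plane R] F ->
  'D_(1, 0) (F \o rescale c e) p = e^-1 * 'D_(1, 0) F (rescale c e p).
Proof.
move=> sF; apply: partial_fst.
  apply: (smooth_on_comp_scalar openT openT (F := rescale c e)) => //.
  exact: smooth_on_rescale openT.
have dF := derive_fst (smooth_on_derivable (v := (1, 0)) sF (p := rescale c e p) I).
have dl : is_derive p.1 1 ((id - cst c.1) * cst e^-1 : R -> R) e^-1.
  by apply: is_derive_eq; rewrite /GRing.scale/= ?fctE; ring.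
rewrite mulrC; exact: (is_derive1_comp (g := (id - cst c.1) * cst e^-1) dF dl).
Qed.

Lemma derive_rescale_snd (R : realType) (F : plane R -> R) (c p : plane R) (e : R) :
  smooth_on [set: plane R] F ->
  'D_(0, 1) (F \o rescale c e) p = e^-1 * 'D_(0, 1) F (rescale c e p).
Proof.
move=> sF; apply: partial_snd.
  apply: (smooth_on_comp_scalar openT openT (F := rescale c e)) => //.
  exact: smooth_on_rescale openT.
have dF := derive_snd (smooth_on_derivable (v := (0, 1)) sF (p := rescale c e p) I).
have dl : is_derive p.2 1 ((id - cst c.2) * cst e^-1 : R -> R) e^-1.
  by apply: is_derive_eq; rewrite /GRing.scale/= ?fctE; ring.
rewrite mulrC; exact: (is_derive1_comp (g := (id - cst c.2) * cst e^-1) dF dl).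
Qed.

Lemma jac_rescale (R : realType) (F G : plane R -> R) (c p : plane R) (e : R) :
  smooth_on [set: plane R] F -> smooth_on [set: plane R] G ->
  jac (F \o rescale c e) (G \o rescale c e) p = e ^- 2 * jac F G (rescale c e p).
Proof.
move=> sF sG; rewrite /jac !derive_rescale_fst// !derive_rescale_snd//.
by rewrite -exprVn; ring.
Qed.

(** * The integral of the Jacobian determinants *)

(** The integral of a nonnegative function is a supremum over the simple functions
    below it, hence monotone without any measurability assumption. The sum of
    brackets is thus compared with an explicit function directly. *)
Lemma ge0_le_integral_sub d (T : measurableType d) (R : realType)
    (mu : {measure set T -> \bar R}) (D D' : set T) (f g : T -> \bar R) :
  D `<=` D' -> (forall x, D x -> (0 <= f x)%E) -> (forall x, D' x -> (0 <= g x)%E) ->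
  (forall x, D x -> (f x <= g x)%E) ->
  (\int[mu]_(x in D) f x <= \int[mu]_(x in D') g x)%E.
Proof.
move=> DD' f0 g0 fg; rewrite !ge0_integralE//.
apply: ge_ereal_sup => _ /= [h hf <-]; apply: ereal_sup_ubound; exists h => //= x.
apply: le_trans (hf x) _; rewrite /patch.
case: ifPn => [/set_mem Dx|_]; first by rewrite mem_set; [exact: fg|exact: DD'].
by case: ifPn => [/set_mem /g0|].
Qed.

Lemma integral_derivative (R : realType) (F f : R -> R) (a b : R) :
  a < b -> (forall x : R, is_derive x 1 F (f x)) -> continuous f ->
  (\int[@lebesgue_measure R]_(x in `[a, b]) (f x)%:E = (F b - F a)%:E)%E.
Proof.
move=> ab dF cf.
have cF : continuous F.
  move=> x; apply: differentiable_continuous; apply/derivable1_diffP.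
  by have [] := dF x.
rewrite (@continuous_FTC2 _ f F)//.
- exact: continuous_subspaceT.
- split.
  + by move=> x _; have [] := dF x.
  + by apply: cvg_at_right_filter; exact: cF.
  + by apply: cvg_at_left_filter; exact: cF.
- by move=> x _; rewrite derive1E; apply: derive_val.
Qed.

Lemma tonelli_bound (R : realType) (phi : R -> R) (psi : R * R -> R)
    (a1 a2 b1 b2 C1 C2 : R) (D : set (plane R)) (g : plane R -> R) :
  measurable_fun setT phi -> measurable_fun setT psi ->
  (forall x, 0 <= phi x) -> (forall p, 0 <= psi p) -> 0 <= C2 ->
  (\int[@lebesgue_measure R]_(x in `[a1, a2]) (phi x)%:E <= C1%:E)%E ->
  (forall x, \int[@lebesgue_measure R]_(y in `[b1, b2]) (psi (x, y))%:E <= C2%:E)%E ->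
  (forall p, D p -> [/\ a1 <= p.1, p.1 <= a2, b1 <= p.2 & p.2 <= b2]) ->
  (forall p, D p -> 0 <= g p <= phi p.1 * psi p) ->
  (\int[@plane_measure R]_(p in D) (g p)%:E <= (C1 * C2)%:E)%E.
Proof.
move=> mphi mpsi phi0 psi0 C20 Iphi Ipsi DAB Dg.
pose A : set R := [set` `[a1, a2]]; pose B : set R := [set` `[b1, b2]].
have mA : measurable A by exact: measurable_itv.
have mB : measurable B by exact: measurable_itv.
pose K (p : R * R) : R := (\1_A p.1 * phi p.1) * (\1_B p.2 * psi p).
have iA x : 0 <= (\1_A x : R) by [].
have iB x : 0 <= (\1_B x : R) by [].
have K0 p : (0 <= (K p)%:E)%E.
  by rewrite lee_fin /K; apply: mulr_ge0; apply: mulr_ge0.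
have mK : measurable_fun setT K.
  apply: measurable_funM; apply: measurable_funM.
  - exact: (measurableT_comp (measurable_indic mA) measurable_fst).
  - exact: (measurableT_comp mphi measurable_fst).
  - exact: (measurableT_comp (measurable_indic mB) measurable_snd).
  - exact: mpsi.
apply: (@le_trans _ _ (\int[@plane_measure R]_p (K p)%:E)%E).
  apply: ge0_le_integral_sub => //.
    by move=> p Dp; rewrite lee_fin; have /andP[] := Dg p Dp.
  move=> p Dp; rewrite lee_fin /K; have [p1 p2 p3 p4] := DAB p Dp.
  have -> : \1_A p.1 = 1 :> R by rewrite indicE mem_set// /A/= in_itv/= p1 p2.
  have -> : \1_B p.2 = 1 :> R by rewrite indicE mem_set// /B/= in_itv/= p3 p4.
  by rewrite !mul1r; have /andP[] := Dg p Dp.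
rewrite fubini_tonelli1//; last exact/measurable_EFinP.
apply: (@le_trans _ _ (\int[@lebesgue_measure R]_(x in A) (C2%:E * (phi x)%:E))%E).
  rewrite [leRHS]integral_mkcond.
  apply: ge0_le_integral_sub => //.
  - by move=> x _; apply: integral_ge0.
  - by move=> x _; apply: erestrict_ge0 => y _; rewrite -EFinM lee_fin mulr_ge0.
  move=> x _; rewrite /fubini_F /patch.
  have -> : (\int[@lebesgue_measure R]_y (K (x, y))%:E =
      (\1_A x * phi x)%:E * \int[@lebesgue_measure R]_(y in B) (psi (x, y))%:E)%E.
    rewrite [in RHS]integral_mkcond -ge0_integralZl//=; last 3 first.
    - apply/(measurable_restrictT _ mB)/measurable_EFinP.
      by apply: measurable_funTS; exact: (measurableT_comp mpsi (measurable_pair1 x)).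
    - by move=> y _; apply: erestrict_ge0 => z _; rewrite lee_fin.
    - by rewrite lee_fin mulr_ge0.
    apply: eq_integral => y _; rewrite /patch /K/= [\1_B y]indicE.
    by case: ifPn => _; rewrite ?mul1r -?EFinM ?mul0r ?mulr0 ?mule0.
  rewrite indicE; case: ifPn => xA; last by rewrite mul0r mul0e.
  by rewrite mul1r muleC lee_wpmul2r// lee_fin.
rewrite ge0_integralZl//.
- by rewrite EFinM muleC lee_wpmul2r.
- by apply/measurable_EFinP; exact: measurable_funTS.
- by move=> x _; rewrite lee_fin.
Qed.

Lemma is_derive_half_square (R : realType) (s ds : R -> R) (a k c x : R) :
  (forall x : R, is_derive x 1 s (ds x)) ->
  is_derive x 1 (fun t => (1 - s (a - (t - c) * k)) ^+ 2 / 2)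
    ((1 - s (a - (x - c) * k)) * ds (a - (x - c) * k) * k).
Proof.
move=> hs.
have dl : is_derive x 1 (cst a - (id - cst c) * cst k : R -> R) (- k).
  by apply: is_derive_eq; rewrite /GRing.scale/= ?fctE; ring.
have d1 := is_derive1_comp (hs ((cst a - (id - cst c) * cst k) x)) dl.
have -> : (fun t => (1 - s (a - (t - c) * k)) ^+ 2 / 2) =
  (cst 1 - (s \o (cst a - (id - cst c) * cst k))) *
  (cst 1 - (s \o (cst a - (id - cst c) * cst k))) * cst (2^-1).
  by apply/funext => t; rewrite expr2.
by apply: is_derive_eq; rewrite /GRing.scale/= ?fctE; field.
Qed.

Lemma is_derive_dip (R : realType) (s ds : R -> R) (a b c k y : R) :
  (forall x : R, is_derive x 1 s (ds x)) ->
  is_derive y 1 (fun t => s (a + 4 * ((t - c) * k - b)) - s (a - 4 * ((t - c) * k - b)))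
    (4 * (ds (a + 4 * ((y - c) * k - b)) + ds (a - 4 * ((y - c) * k - b))) * k).
Proof.
move=> hs.
pose l : R -> R := cst 4 * ((id - cst c) * cst k - cst b).
have dl : is_derive y 1 l (4 * k).
  by apply: is_derive_eq; rewrite /GRing.scale/= ?fctE; ring.
have dl1 := is_deriveD (is_derive_cst a y 1) dl; rewrite add0r in dl1.
have dl2 := is_deriveB (is_derive_cst a y 1) dl; rewrite sub0r in dl2.
have d1 := is_derive1_comp (hs ((cst a + l) y)) dl1.
have d2 := is_derive1_comp (hs ((cst a - l) y)) dl2.
have -> : (fun t => s (a + 4 * ((t - c) * k - b)) - s (a - 4 * ((t - c) * k - b))) =
  (s \o (cst a + l)) - (s \o (cst a - l)) by [].
apply: is_derive_eq (is_deriveB d1 d2) _.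
by rewrite mulrN opprK -mulrDl mulrCA mulrA.
Qed.

Section Integral.
Context (R : realType) (n : nat) (c : plane R) (e : R).
Hypotheses (n0 : (0 < n)%N) (e0 : 0 < e).

Let Y : R := 3 * n%:R + 1.

Let phi (x : R) : R := n%:R^-1 *
  ((1 - step (1 + 1 - (x - c.1) * e^-1)) * dstep (1 + 1 - (x - c.1) * e^-1) * e^-1).

Let psi1 (i : nat) (p : R * R) : R :=
  4 * (dstep (1 + 1 + 4 * ((p.2 - c.2) * e^-1 - i%:R * ((p.1 - c.1) * e^-1))) +
       dstep (1 + 1 - 4 * ((p.2 - c.2) * e^-1 - i%:R * ((p.1 - c.1) * e^-1)))) * e^-1.

Let psi (p : R * R) : R := \sum_(i < n.+1) psi1 i p.

Let en0 : 0 <= e^-1. Proof. by rewrite invr_ge0 ltW. Qed.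

Let phi_ge0 x : 0 <= phi x.
Proof.
apply: mulr_ge0; first by rewrite invr_ge0 ler0n.
apply: mulr_ge0 => //; apply: mulr_ge0; last exact: dstep_ge0.
by rewrite subr_ge0 step_le1.
Qed.

Let psi1_ge0 i p : 0 <= psi1 i p.
Proof.
apply: mulr_ge0 => //; apply: mulr_ge0 => //.
by apply: addr_ge0; exact: dstep_ge0.
Qed.

Let psi_ge0 p : 0 <= psi p.
Proof. by apply: sumr_ge0 => i _. Qed.

Let continuous_phi : continuous phi.
Proof.
have cl : continuous (fun x : R => 1 + 1 - (x - c.1) * e^-1).
  move=> x; apply: cvgB; first exact: cvg_cst.
  by apply: cvgM; [apply: cvgB; [exact: cvg_id|exact: cvg_cst]|exact: cvg_cst].
have cs : continuous (fun x : R => step (1 + 1 - (x - c.1) * e^-1)).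
  by move=> x; exact: (continuous_comp (cl x) (@continuous_step R _)).
have cds : continuous (fun x : R => dstep (1 + 1 - (x - c.1) * e^-1)).
  by move=> x; exact: (continuous_comp (cl x) (@continuous_dstep R _)).
move=> x; apply: cvgM; first exact: cvg_cst.
apply: cvgM; last exact: cvg_cst.
by apply: cvgM; [apply: cvgB; [exact: cvg_cst|exact: cs]|exact: cds].
Qed.

Let integral_phi a b : a < b ->
  (\int[@lebesgue_measure R]_(x in `[a, b]) (phi x)%:E <= (n%:R^-1 / 2)%:E)%E.
Proof.
move=> ab.
pose F (x : R) := n%:R^-1 * ((1 - step (1 + 1 - (x - c.1) * e^-1)) ^+ 2 / 2).
have dF (x : R) : is_derive x 1 F (phi x).
  apply: is_derive_cmul; exact: (is_derive_half_square _ _ _ _ (@is_derive_step R)).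
rewrite (integral_derivative ab dF continuous_phi) lee_fin.
have n1 : 0 <= n%:R^-1 :> R by rewrite invr_ge0 ler0n.
rewrite -mulrBr ler_wpM2l//.
have s0 x : 0 <= 1 - step x :> R by rewrite subr_ge0 step_le1.
have s1 x : 1 - step x <= 1 :> R by rewrite lerBlDr lerDl step_ge0.
have sq (s t : R) : 0 <= s -> s <= 1 -> s ^+ 2 / 2 - t ^+ 2 / 2 <= 2^-1.
  by move=> *; have := sqr_ge0 t; nra.
exact: (sq _ _ (s0 _) (s1 _)).
Qed.

Let integral_psi x a b : a < b ->
  (\int[@lebesgue_measure R]_(y in `[a, b]) (psi (x, y))%:E <= (2 * n.+1%:R)%:E)%E.
Proof.
move=> ab.
pose s (i : 'I_n.+1) (y : R) :=
  step (1 + 1 + 4 * ((y - c.2) * e^-1 - i%:R * ((x - c.1) * e^-1))) -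
  step (1 + 1 - 4 * ((y - c.2) * e^-1 - i%:R * ((x - c.1) * e^-1))).
have ds i (y : R) : is_derive y 1 (s i) (psi1 i (x, y)).
  exact: (is_derive_dip _ _ _ _ _ (@is_derive_step R)).
have dF (y : R) : is_derive y 1 (\sum_(i < n.+1) s i) (psi (x, y)).
  exact: is_derive_sum.
have cpsi : continuous (fun y => psi (x, y)).
  have cds (h : R -> R) : continuous h -> continuous (fun y => dstep (h y)).
    by move=> ch y; exact: (continuous_comp (ch y) (@continuous_dstep R _)).
  have cl i : continuous
      (fun y : R => 4 * ((y - c.2) * e^-1 - i%:R * ((x - c.1) * e^-1))).
    move=> y; apply: cvgM; first exact: cvg_cst.
    apply: cvgB; last exact: cvg_cst.
    by apply: cvgM; [apply: cvgB; [exact: cvg_id|exact: cvg_cst]|exact: cvg_cst].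
  have -> : (fun y => psi (x, y)) = \sum_(i < n.+1) (fun y => psi1 i (x, y)).
    by apply/funext => y; rewrite fct_sumE.
  apply: (big_ind (fun g : R -> R => continuous g)).
  - by move=> y; exact: cvg_cst.
  - by move=> g h cg ch y; apply: cvgD; [exact: cg|exact: ch].
  move=> i _ y; apply: cvgM; last exact: cvg_cst.
  apply: cvgM; first exact: cvg_cst.
  apply: cvgD; [apply: (cds (fun y => 1 + 1 + _))|apply: (cds (fun y => 1 + 1 - _))].
    by move=> z; apply: cvgD; [exact: cvg_cst|exact: cl].
  by move=> z; apply: cvgB; [exact: cvg_cst|exact: cl].
rewrite (integral_derivative ab dF cpsi) lee_fin.
rewrite !fct_sumE -sumrB.
apply: (@le_trans _ _ (\sum_(i < n.+1) 2)); last first.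
  by rewrite sumr_const card_ord mulr_natr.
apply: ler_sum => i _; rewrite /s.
have aux (a' b' c' d' : R) : a' <= 1 -> 0 <= b' -> 0 <= c' -> d' <= 1 ->
    (a' - b') - (c' - d') <= 2 by move=> *; lra.
by apply: aux; rewrite ?step_ge0 ?step_le1.
Qed.

Let measurable_psi : measurable_fun setT psi.
Proof.
apply: measurable_sum => i.
have mdstep : measurable_fun setT (@dstep R).
  by apply: continuous_measurable_fun; exact: continuous_dstep.
pose l (p : R * R) : R := 4 * ((p.2 - c.2) * e^-1 - i%:R * ((p.1 - c.1) * e^-1)).
have mc (t : R) : measurable_fun [set: R * R] (cst t : R * R -> R).
  exact: measurable_cst.
have ml : measurable_fun setT l.
  apply: measurable_funM; first exact: mc.
  apply: measurable_funB.
    apply: measurable_funM; last exact: mc.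
    by apply: measurable_funB; [exact: measurable_snd|exact: mc].
  apply: measurable_funM; first exact: mc.
  apply: measurable_funM; last exact: mc.
  by apply: measurable_funB; [exact: measurable_fst|exact: mc].
apply: measurable_funM; last exact: mc.
apply: measurable_funM; first exact: mc.
apply: measurable_funD.
  apply: (measurableT_comp mdstep (g := fun p => 1 + 1 + l p)).
  by apply: measurable_funD; [exact: mc|exact: ml].
apply: (measurableT_comp mdstep (g := fun p => 1 + 1 - l p)).
by apply: measurable_funB; [exact: mc|exact: ml].
Qed.

(** Along y, each factor 1 - slit goes down from 1 to 0 and up again: its total
    variation is 2, for each of the n + 1 slits. Along x, the factor 1 - hill times
    the derivative of the hill integrates to 1/2. The weight is 1 / n. *)
Lemma integral_jac (g : plane R -> R) :
  (forall p, hill_disc n (rescale c e p) ->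
    0 <= g p <= \sum_(i < n.+1) jac_bound n i (rescale c e p) / e ^+ 2) ->
  (\int[@plane_measure R]_(p in rescale c e @^-1` hill_disc n) (g p)%:E <=
    (n.+1%:R / n%:R)%:E)%E.
Proof.
move=> gP.
have -> : n.+1%:R / n%:R = n%:R^-1 / 2 * (2 * n.+1%:R) :> R.
  by field; rewrite pnatr_eq0 -lt0n.
apply: (@tonelli_bound R phi psi (c.1 - 3 * e) (c.1 + 3 * e)
  (c.2 - (Y + 2) * e) (c.2 + (Y + 2) * e)).
- by apply: continuous_measurable_fun; exact: continuous_phi.
- exact: measurable_psi.
- exact: phi_ge0.
- exact: psi_ge0.
- by rewrite mulr_ge0// ler0n.
- by apply: integral_phi; rewrite ltrD2l gtrN ?mulr_gt0.
- move=> x; apply: integral_psi; rewrite ltrD2l gtrN ?mulr_gt0//.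
  by rewrite /Y; have : 0 <= n%:R :> R by []; move=> ?; lra.
- move=> p []; rewrite !mul0r !subr0 add0r -/Y /=.
  rewrite !ltr_pdivlMr// !ltr_pdivrMr// => p1 p2 p3 p4.
  by split; lra.
- move=> p pD; have /andP[g1 g2] := gP p pD; rewrite g1 (le_trans g2)//.
  rewrite le_eqVlt; apply/orP; left; apply/eqP.
  rewrite /psi mulr_sumr; apply: eq_bigr => i _.
  rewrite /jac_bound /phi /psi1 /rescale/= -exprVn.
  by ring.
Qed.

End Integral.

(** * Star-shaped sets and finitely supported sums *)

Lemma starshaped_connected (R : realType) (A : set (plane R)) (a : plane R) :
  (forall p t, A p -> 0 <= t <= 1 -> A (a + t *: (p - a))) -> connected A.
Proof.
move=> Aa.
pose seg (p : plane R) : set (plane R) :=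
  (fun t : R => a + t *: (p - a)) @` [set` `[0, 1]].
have -> : A = \bigcup_(p in A) seg p.
  apply/seteqP; split=> [p Ap|p [q Aq [t /= t01 <-]]].
    exists p => //; exists 1; first by rewrite /= in_itv/= ler01 lexx.
    by rewrite scale1r addrC subrK.
  by apply: Aa => //; rewrite in_itv/= in t01.
apply: bigcup_connected.
  exists a => p _; exists 0; first by rewrite /= in_itv/= lexx ler01.
  by rewrite scale0r addr0.
move=> p _; apply: connected_continuous_connected; first exact: segment_connected.
apply: continuous_subspaceT => t.
by apply: cvgD; [exact: cvg_cst|apply: cvgZr_tmp; exact: cvg_id].
Qed.

Lemma fsum_ge_seq (R : realType) (I : choiceType) (f : I -> R) (r : seq I) :
  (forall i, 0 <= f i) -> finite_set [set i | f i != 0] -> uniq r ->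
  \sum_(i <- r) f i <= \sum_(i \in [set: I]) f i.
Proof.
move=> f0 fin ur.
pose r' := [seq x <- fset_set [set i | f i != 0] | x \notin r].
rewrite (fsbigE (r ++ r')) //=.
- under [leRHS]eq_bigl do rewrite in_setT.
  by rewrite big_cat/= lerDl sumr_ge0.
- rewrite cat_uniq ur filter_uniq ?fset_uniq// andbT.
  apply/hasPn => x; rewrite mem_filter => /andP[+ _]; exact.
- move=> i _; rewrite mem_cat negb_or mem_filter => /andP[ir].
  rewrite ir/= in_fset_set// => /negP H; apply: contrapT => /eqP fi.
  by apply: H; rewrite inE.
Qed.

(** * Brackets in the preferred chart *)

Lemma bracket_algebra (R : realType) (g1 g2 h1 h2 a b a' b' z : R) :
  - g1 = (a * 0 - b * 1) * z -> - g2 = (a * 1 - b * 0) * z ->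
  - h1 = (a' * 0 - b' * 1) * z -> - h2 = (a' * 1 - b' * 0) * z ->
  - (g1 * h2 - g2 * h1) = - ((a * b' - b * a') * z) * z.
Proof.
rewrite !(mulr0, mulr1, sub0r, subr0) => G1 G2 H1 H2.
rewrite -[g1]opprK -[g2]opprK -[h1]opprK -[h2]opprK G1 G2 H1 H2.
by ring.
Qed.

Section Bracket.
Context (R : realType) (M : topologicalType) (S : smooth_surface R M) (w : area_form S).

Lemma form_coord (x : M) (a b a' b' : R) :
  w x (a, b) (a', b') = (a * b' - b * a') * w x (1, 0) (0, 1).
Proof.
have w0 (z : plane R) : w x 0 z = 0.
  have := form_linear w x 1 0 0 z; rewrite scale1r add0r mul1r => /eqP.
  by rewrite -subr_eq0 opprD addNKr oppr_eq0 => /eqP.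
have w00 (u : plane R) : w x u u = 0.
  by have := form_antisym w x u u; move: (w x u u) => t; lra.
have wD (u v : R) (y : plane R) : w x (u, v) y = u * w x (1, 0) y + v * w x (0, 1) y.
  by rewrite [(u, v)](planeE) -[_.2 *: _]addr0 !form_linear w0 addr0.
have a1 := form_antisym w x (1, 0) (a', b').
have a2 := form_antisym w x (0, 1) (a', b').
have a3 := form_antisym w x (0, 1) (1, 0).
rewrite wD in a1; rewrite wD in a2; rewrite w00 in a1; rewrite w00 in a2.
by rewrite wD a1 a2 a3; ring.
Qed.

(** In the preferred chart, w is its density times the determinant, and the
    coordinates of a symplectic gradient are partial derivatives divided by the
    density. The bracket is the Jacobian determinant divided by the density. *)
Lemma poisson_bracket_jac (G H : M -> R) (x : M) (c := chart_at S x) :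
  differentiable (G \o chart_inv c) (chart_map c x) ->
  differentiable (H \o chart_inv c) (chart_map c x) ->
  `|poisson_bracket w G H x| * `|w x (1, 0) (0, 1)| =
  `|jac (G \o chart_inv c) (H \o chart_inv c) (chart_map c x)|.
Proof.
move=> dG dH; rewrite -normrM /poisson_bracket /jac.
rewrite !deriveE//.
have E F v : - 'd (F \o chart_inv c) (chart_map c x) v = w x (symplectic_gradient w F x) v.
  exact: symplectic_gradientP.
have G1 := E G (1, 0); have G2 := E G (0, 1).
have H1 := E H (1, 0); have H2 := E H (0, 1).
move: G1 G2 H1 H2.
case: (symplectic_gradient w G x) => a b; case: (symplectic_gradient w H x) => a' b'.
rewrite (form_coord x a b 1 0) (form_coord x a b 0 1).
rewrite (form_coord x a' b' 1 0) (form_coord x a' b' 0 1) (form_coord x a b a' b').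
by move=> G1 G2 H1 H2; rewrite -[RHS]normrN (bracket_algebra G1 G2 H1 H2).
Qed.

End Bracket.

Section Chart.
Context (R : realType) (M : topologicalType) (S : smooth_surface R M).

(** The construction is carried out in this chart: no change of coordinates occurs,
    since the integral and the brackets are read in it on its whole domain. *)
Lemma first_chart : exists m, (exists x, chart_dom (atlas S m) x) /\
  forall x, chart_dom (atlas S m) x -> chart_index S x = m.
Proof.
have ex : exists m, `[< exists x, chart_dom (atlas S m) x >].
  have [m xm] := atlas_cover S (chart_inv (atlas S 0) 0).
  by exists m; apply/asboolP; exists (chart_inv (atlas S 0) 0).
case: (ex_minnP ex) => m /asboolP dm mmin; exists m; split => // x xm.
rewrite /chart_index; case: ex_minnP => k /asboolP xk kmin.
apply/eqP; rewrite eqn_leq kmin/=; last exact/asboolP.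
by apply: mmin; apply/asboolP; exists x.
Qed.

Lemma nbhs_chart (c : chart R M) (x : M) (B : set M) : chart_dom c x -> nbhs x B ->
  nbhs (chart_map c x) (chart_cod c `&` chart_inv c @^-1` B).
Proof.
move=> cx xB.
have oB := open_chart_image (c := c) (@open_interior _ B).
rewrite chart_imageE in oB.
apply: (@filterS _ _ _ (chart_cod c `&` chart_inv c @^-1` B°)).
  by move=> p [cp /interior_subset].
apply: open_nbhs_nbhs; split => //.
by split; [exact: chart_map_cod|rewrite /preimage/= chart_mapK].
Qed.

End Chart.

(** * The construction on the surface *)

Section Construction.
Context (R : realType) (M : topologicalType) (S : smooth_surface R M) (w : area_form S).
Context (n m : nat) (p0 : plane R) (e : R).
Hypotheses (n0 : (0 < n)%N) (e0 : 0 < e).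

Let c := atlas S m.
Let T := rescale p0 e.
Let Y : R := 3 * n%:R + 1.

Hypothesis index_m : forall x, chart_dom c x -> chart_index S x = m.
Hypothesis rect_cod : T @^-1` rect 5 (Y + 4) `<=` chart_cod c.
Hypothesis shore_cod : forall i, (i <= n)%N -> T @^-1` shore_disc n i `<=` chart_cod c.

Let K := chart_preim c (T @^-1` rect 3 (Y + 2)).
Let W := chart_preim c (T @^-1` rect 4 (Y + 3)).

Context (A : set (nat * M)) (V : nat * M -> set M) (g : nat * M -> M -> R).
Hypothesis farP : forall j, A j -> [/\ disc S (V j), V j `&` K = set0,
  smooth_fun S (g j), forall y, 0 <= g j y & support_of (g j) `<=` V j].
Hypothesis far_lf : forall x : M,
  exists2 N, nbhs x N & finite_set [set j | A j /\ V j `&` N !=set0].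
Hypothesis far_ge1 : forall x, ~ W x -> exists2 j, A j & 1 <= g j x.

Let I : choiceType := (option 'I_n.+1 + set_type A)%type.

Definition members (k : I) : set M :=
  match k with
  | inl None => chart_preim c (T @^-1` @hill_disc R n)
  | inl (Some i) => chart_preim c (T @^-1` @shore_disc R n i)
  | inr j => V (val j)
  end.

Definition functions (k : I) : M -> R :=
  match k with
  | inl None => transplant c (hill n \o T)
  | inl (Some i) => transplant c (shore n i \o T)
  | inr j => g (val j)
  end.

Let hub : I := inl None.

Let nR : 1 <= n%:R :> R. Proof. by rewrite ler1n. Qed.
Let eN : e != 0. Proof. by rewrite gt_eqF. Qed.
Let hM : hausdorff_space M. Proof. exact: surface_hausdorff S. Qed.

Let farV (j : set_type A) : [/\ disc S (V (val j)), V (val j) `&` K = set0,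
  smooth_fun S (g (val j)), forall y, 0 <= g (val j) y &
  support_of (g (val j)) `<=` V (val j)].
Proof. by apply: farP; exact: set_valP. Qed.

Let ordn (i : 'I_n.+1) : (i <= n)%N. Proof. by rewrite -ltnS. Qed.

Let rectS a b a' b' : a <= a' -> b <= b' -> @rect R a b `<=` rect a' b'.
Proof. by move=> aa bb q [q1 q2 q3 q4]; split; lra. Qed.

Let hill_discS : @hill_disc R n `<=` rect 3 (Y + 2).
Proof.
by move=> q []; rewrite !mul0r subr0 add0r -/Y => *; split; exact: ltW.
Qed.

Let hill_cod : T @^-1` hill_disc n `<=` chart_cod c.
Proof.
move=> p /hill_discS H; apply: rect_cod.
by apply: rectS H; lra.
Qed.

Let membersK x : members hub x -> K x.
Proof. by move=> [cx /hill_discS]. Qed.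

Let disc_hill : planar_disc (@hill_disc R n).
Proof.
have Y0 : 0 < Y + 2 by rewrite /Y; have : 0 <= n%:R :> R by []; lra.
by apply: graph_region_disc => //; lra.
Qed.

Let disc_shore i : planar_disc (@shore_disc R n i).
Proof.
have L0 : 0 < slit_width R n.
  by rewrite /slit_width; have : 0 <= n%:R :> R by []; lra.
by apply: graph_region_disc => //; lra.
Qed.

Lemma members_disc k : disc S (members k).
Proof.
case: k => [[i|]|j] /=.
- by apply: disc_chart_preim; [exact: planar_disc_rescale|exact: shore_cod].
- by apply: disc_chart_preim; [exact: planar_disc_rescale|exact: hill_cod].
- by have [] := farV j.
Qed.

Lemma members_locally_finite : locally_finite_family members.
Proof.
move=> x; have [N xN fin] := far_lf x; exists N => //.
apply: (@sub_finite_set _ _ ((inl @` [set: option 'I_n.+1]) `|`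
    (inr @` [set j : set_type A | A (val j) /\ V (val j) `&` N !=set0]))).
  move=> [k|j] /= H; first by left; exists k.
  by right; exists j => //; split => //; exact: set_valP.
rewrite finite_setU; split; apply: finite_image; first exact: finite_finset.
apply: (@finite_preimage _ _ _ (fun j : set_type A => val j) _ fin).
by move=> i j _ _; exact: val_inj.
Qed.

Let support_hill p : (hill n \o T) p != 0 -> (T @^-1` rect 2 (Y + 1)) p.
Proof. by move=> /mesa_out; rewrite -/Y; apply: rectS; lra. Qed.

Lemma functions_subordinate : subordinate functions members.
Proof.
move=> [[i|]|j] /=.
- apply: (support_transplant hM (K := T @^-1` shore_support n i)).
  + by apply: compact_rescale => //; exact: compact_shore_support.
  + by move=> p; exact: shore_support_sub.
  + exact: shore_cod.
  + by move=> p; exact: shore_supportP.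
- apply: (support_transplant hM (K := T @^-1` rect 2 (Y + 1))).
  + by apply: compact_rescale => //; exact: compact_rect.
  + move=> p [p1 p2 p3 p4]; rewrite /hill_disc /preimage/=.
    by split; rewrite ?mul0r ?subr0 ?add0r -/Y; lra.
  + exact: hill_cod.
  + exact: support_hill.
- by have [] := farV j.
Qed.

Let smoothT O : open O -> smooth_on O T. Proof. exact: smooth_on_rescale. Qed.

Let smooth_model (F : plane R -> R) O : open O ->
  smooth_on [set: plane R] F -> smooth_on O (F \o T).
Proof.
by move=> oO; apply: (smooth_on_comp_scalar oO openT) => //; exact: smoothT.
Qed.

Lemma functions_smooth k : smooth_fun S (functions k).
Proof.
have oc : open (chart_cod c) by exact: (@chart_cod_open _ _ c).
case: k => [[i|]|j] /=.
- apply: (smooth_transplant (m := m) (K := T @^-1` shore_support n i)).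
  + by apply: smooth_model => //; exact: smooth_on_shore openT.
  + by apply: compact_rescale => //; exact: compact_shore_support.
  + by move=> p /(shore_support_sub (ordn i)); exact: shore_cod.
  + by move=> p; exact: shore_supportP.
- apply: (smooth_transplant (m := m) (K := T @^-1` rect 2 (Y + 1))).
  + by apply: smooth_model => //; exact: smooth_on_hill openT.
  + by apply: compact_rescale => //; exact: compact_rect.
  + by move=> p H; apply: rect_cod; apply: rectS H; lra.
  + exact: support_hill.
- by have [] := farV j.
Qed.

Lemma functions_ge0 k x : 0 <= functions k x.
Proof.
case: k => [[i|]|j] /=.
- by apply: transplant_ge0 => p; exact: shore_ge0.
- by apply: transplant_ge0 => p; exact: mesa_ge0.
- by have [] := farV j.
Qed.

Let functions_members k x : functions k x != 0 -> members k x.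
Proof. by move=> H; apply: functions_subordinate; exact: subset_closure. Qed.

Lemma functions_finite x : finite_set [set k | functions k x != 0].
Proof.
have [N xN fin] := members_locally_finite x.
apply: sub_finite_set fin => k /= /functions_members kx.
by exists x; split => //; exact: nbhs_singleton.
Qed.

(** Inside W the hill and the shores suffice; outside, one of the far functions is
    at least 1. *)
Lemma functions_sum_ge1 x : 1 <= \sum_(k \in [set: I]) functions k x.
Proof.
have H r := fsum_ge_seq (r := r) (fun k => functions_ge0 k x) (functions_finite x).
have [[cx Wx]|/far_ge1[j Aj]] := pselect (W x); last first.
  move=> gx; apply: le_trans gx _.
  have jA : j \in A by rewrite inE.
  have := H [:: inr (exist _ j jA)] isT; rewrite big_seq1; exact.
pose r : seq I := hub :: [seq inl (Some i) | i <- enum 'I_n.+1].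
have ur : uniq r.
  rewrite /= map_inj_uniq ?enum_uniq ?andbT; last by move=> i j [].
  by apply/mapP => -[].
apply: le_trans (H r ur); rewrite /r big_cons big_map big_enum/=.
rewrite transplantE//; under eq_bigr do rewrite transplantE//.
exact: hill_shore_ge1.
Qed.

Lemma functions_positive : positive_collection S functions.
Proof.
split.
- move=> x; have [N xN fin] := members_locally_finite x; exists N => //.
  apply: sub_finite_set fin => k /= [y [ky Ny]]; exists y; split => //.
  exact: functions_subordinate.
- exact: functions_smooth.
- exact: functions_ge0.
- exact: functions_sum_ge1.
Qed.

Lemma members_disc_cover : disc_cover S members.
Proof.
split; [exact: members_disc|exact: members_locally_finite|].
apply/seteqP; split=> // x _; apply: contrapT => xU.
have := functions_sum_ge1 x; rewrite fsbig1 ?ler10// => k _.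
apply: contrapT => /eqP /functions_members kx; apply: xU; by exists k.
Qed.

Let Tinv (q : plane R) : plane R := ((q.1 - 0) * e + p0.1, (q.2 - 0) * e + p0.2).

Let TK q : T (Tinv q) = q.
Proof. by rewrite /T /rescale /= !subr0 !addrK !mulfK//; case: (q). Qed.

(** The centre of the hill is missed by the shore discs and by the far discs. *)
Lemma hub_essential : essential members hub.
Proof.
move=> H; pose x := chart_inv c (Tinv (0, 0)).
have nn : 0 <= n%:R :> R by [].
have pc : chart_cod c (Tinv (0, 0)).
  by apply: rect_cod; rewrite /preimage/= TK; split => /=; rewrite /Y; lra.
have cx : chart_dom c x by exact: chart_inv_dom.
have mx : T (chart_map c x) = (0, 0) by rewrite chart_invK.
have : [set: M] x by [].
rewrite -H => -[[[i|]|j] //= _].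
  by move=> [_]; rewrite /preimage/= mx; exact: shore_disc0.
have [_ VK _ _ _] := farV j => Vx.
have : (V (val j) `&` K) x.
  by split => //; split => //; rewrite /preimage/= mx; split => /=; rewrite /Y; lra.
by rewrite VK.
Qed.

Let side : set (plane R) := T @^-1` [set q | [/\ q.1 = 3, - (Y + 2) < q.2 & q.2 < Y + 2]].

Let side_cod : side `<=` chart_cod c.
Proof. by move=> p [p1 p2 p3]; apply: rect_cod; split; rewrite ?p1; lra. Qed.

Let T_line (a p : plane R) t :
  T (a + t *: (p - a)) = ((T a).1 + t * ((T p).1 - (T a).1),
                          (T a).2 + t * ((T p).2 - (T a).2)).
Proof. by rewrite /T /rescale; congr pair; rewrite /= /GRing.scale/=; ring. Qed.

Let connected_side : connected side.
Proof.
apply: (@starshaped_connected R side (Tinv (3, 0))) => p t [p1 p2 p3] /andP[t0 t1].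
rewrite /side /preimage /mkset T_line TK; case: (T p) p1 p2 p3 => x y /= -> y1 y2.
by split; rewrite /= ?add0r ?subr0; [ring|nra|nra].
Qed.

Lemma hub_connected : connected (members hub).
Proof.
apply: connected_chart_preim; first exact: hill_cod.
apply: (@starshaped_connected R _ (Tinv (0, 0))) => p t pD /andP[t0 t1].
move: pD; rewrite /preimage /mkset T_line TK; case: (T p) => x y [] /=.
rewrite !mul0r !subr0 !add0r -/Y => x1 x2 y1 y2.
by split; rewrite /= ?mul0r ?subr0 ?add0r -/Y; nra.
Qed.

Let side_frontier : chart_preim c side `<=` frontier (closure (members hub)).
Proof.
have cK : closed K.
  apply: closed_chart_preim => //.
    by move=> p H; apply: rect_cod; apply: rectS H; lra.
  by apply: compact_rescale => //; exact: compact_rect.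
move=> x [cx [x1 x2 x3]].
have eV : 0 < e^-1 by rewrite invr_gt0.
split.
(* Moving left from the side enters the rectangle. *)
- apply: subset_closure.
  move=> B xB; have := nbhs_chart cx xB.
  move=> /plane_nbhsP[r r0 Hr].
  pose d := Num.min (r / 2) e.
  have d0 : 0 < d by rewrite lt_min e0 divr_gt0.
  have dr : d < r by rewrite gt_min ltr_pdivrMr// mulr_natr mulr2n ltrDl r0.
  have de : d <= e by rewrite ge_min lexx orbT.
  pose p : plane R := ((chart_map c x).1 - d, (chart_map c x).2).
  have [cp Bp] : (chart_cod c `&` chart_inv c @^-1` B) p.
    apply: Hr => /=; last by rewrite subrr normr0.
    by rewrite addrAC subrr add0r normrN gtr0_norm.
  exists (chart_inv c p); split => //; split; first exact: chart_inv_dom.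
  rewrite /preimage/= chart_invK//.
  have T1 : (T p).1 = 3 - d * e^-1 by rewrite -x1 /T /rescale/=; ring.
  have T2 : (T p).2 = (T (chart_map c x)).2 by [].
  have de0 : 0 < d * e^-1 by rewrite mulr_gt0.
  have de1 : d * e^-1 <= 1 by rewrite ler_pdivrMr// mul1r.
  by split; rewrite ?mul0r ?subr0 ?add0r -/Y ?T1 ?T2//; lra.
(* Moving right from the side leaves the closed rectangle. *)
- move=> xI.
  have xK : nbhs x K.
    apply: filterS xI => y; move/closure_id: cK => ->; apply: closureS.
    exact: membersK.
  have := nbhs_chart cx xK.
  move=> /plane_nbhsP[r r0 Hr].
  pose p : plane R := ((chart_map c x).1 + r / 2, (chart_map c x).2).
  have r2 : 0 < r / 2 by rewrite divr_gt0.
  have [cp [_ Bp]] : (chart_cod c `&` chart_inv c @^-1` K) p.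
    apply: Hr => /=; last by rewrite subrr normr0.
    by rewrite addrAC subrr add0r gtr0_norm// ltr_pdivrMr// mulr_natr mulr2n ltrDl.
  move: Bp; rewrite /preimage/= chart_invK// => -[_ p1 _ _].
  have T1 : (T p).1 = 3 + r / 2 * e^-1 by rewrite -x1 /T /rescale/=; ring.
  by move: p1; rewrite T1 leNgt ltrDl mulr_gt0.
Qed.

(** The open right side of the rectangle is a connected part of the frontier, and it
    crosses all the rays: it contains a point missed by each shore
    disc. The rectangle is open and the far discs avoid its closure, so they miss
    the side entirely. *)
Lemma hub_confined : confined members (members hub).
Proof.
split; first exact: hub_connected.
have nn : 0 <= n%:R :> R by [].
pose z y := chart_inv c (Tinv (3, y)).
have zP y : - (Y + 2) < y -> y < Y + 2 ->
    chart_preim c side (z y) /\ T (chart_map c (z y)) = (3, y).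
  move=> y1 y2; have H : side (Tinv (3, y)) by rewrite /side /preimage /mkset TK.
  have cH := side_cod H.
  split; last by rewrite chart_invK// TK.
  by split; [exact: chart_inv_dom|rewrite /z chart_invK].
have [z0 Tz0] : chart_preim c side (z 0) /\ T (chart_map c (z 0)) = (3, 0).
  by apply: zP; rewrite /Y; lra.
exists (z 0); first exact: side_frontier.
have sub : chart_preim c side `<=` connected_component (frontier (closure (members hub))) (z 0).
  by apply: connected_component_max => //; apply: connected_chart_preim.
move=> [[i|]|j] H.
- have iR : i%:R <= n%:R :> R by rewrite ler_nat.
  have i0 : 0 <= i%:R :> R by [].
  (* The side crosses the i-th ray at this point. *)
  have [zi Tzi] : chart_preim c side (z (i%:R * 3)) /\
      T (chart_map c (z (i%:R * 3))) = (3, i%:R * 3).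
    by apply: zP; rewrite /Y; lra.
  have [_] := H _ (sub _ zi); rewrite /preimage/= Tzi; exact: shore_disc3.
- have [_] := H _ (sub _ z0); rewrite /preimage/= Tz0 => -[/= _ _ _].
  by rewrite mul0r add0r ltxx.
- have Vz := H _ (sub _ z0); have [_ VK _ _ _] := farV j.
  have : (V (val j) `&` K) (z 0).
    split => //; have [cz _] := z0; split => //.
    by rewrite /preimage/= Tz0; split => /=; rewrite /Y; lra.
  by rewrite VK.
Qed.

Let functions_diff k p : chart_cod c p ->
  differentiable (functions k \o chart_inv c) p.
Proof.
move=> cp; apply: (smooth_on_differentiable (@chart_cod_open _ _ c) _ cp).
exact: functions_smooth.
Qed.

Let near_transplant F p : chart_cod c p ->
  \forall q \near p, (transplant c F \o chart_inv c) q = F q.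
Proof.
move=> cp; apply: filterS (open_nbhs_nbhs (conj (@chart_cod_open _ _ c) cp)) => q cq.
by rewrite /= transplantE ?chart_invK//; exact: chart_inv_dom.
Qed.

Let jac_functions (i : 'I_n.+1) p : (T @^-1` hill_disc n) p ->
  `|jac (functions (inl (Some i)) \o chart_inv c) (functions hub \o chart_inv c) p| <=
  jac_bound n i (T p) / e ^+ 2.
Proof.
move=> pD; have cp := hill_cod pD.
rewrite (jac_near (near_transplant _ cp) (near_transplant _ cp)).
rewrite jac_rescale; [|exact: smooth_on_shore openT|exact: smooth_on_hill openT].
rewrite normrM ger0_norm ?invr_ge0 ?sqr_ge0// mulrC ler_wpM2r ?invr_ge0 ?sqr_ge0//.
exact: jac_shore_hill.
Qed.

Let jac_self F p : @jac R F F p = 0.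
Proof. by rewrite /jac mulrC subrr. Qed.

Let jac_far (j : set_type A) p : (T @^-1` hill_disc n) p ->
  jac (functions (inr j) \o chart_inv c) (functions hub \o chart_inv c) p = 0.
Proof.
move=> pD; have oD : open (T @^-1` @hill_disc R n).
  by have [] := planar_disc_rescale p0 eN disc_hill.
have Z : \forall q \near p, (functions (inr j) \o chart_inv c) q = cst 0 q.
  apply: filterS (open_nbhs_nbhs (conj oD pD)) => q qD /=.
  apply: contrapT => /eqP /(functions_members (k := inr j)) Vq.
  have [_ VK _ _ _] := farV j.
  have : (V (val j) `&` K) (chart_inv c q); last by rewrite VK.
  have cq := hill_cod qD.
  split => //; split; first exact: chart_inv_dom.
  by rewrite chart_invK//; exact: hill_discS.
exact: jac_near0.
Qed.

(** Only the cell of the chosen chart contributes. There the far functions vanish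
    near each point of the rectangle and the hill has bracket 0 with itself, which
    leaves the Jacobian determinants of the shores with the hill. *)
Lemma hub_integral :
  (integral_form w (members hub) (fun x =>
     \sum_(k \in [set: I]) `|poisson_bracket w (functions k) (functions hub) x|)%R
   <= (n.+1%:R / n%:R)%:E)%E.
Proof.
rewrite /integral_form (nneseriesD1 (n := m))//; last first.
  move=> k _; apply: integral_ge0 => p _; rewrite lee_fin mulr_ge0//.
  by rewrite sumr_ge0.
rewrite eseries0 ?adde0; last first.
  move=> k _ /andP[_ km].
  have -> : members hub `&` cell S k = set0.
    apply/seteqP; split=> // x [[cx _] xk]; move/eqP: km; apply.
    by rewrite -xk index_m.
  by rewrite image_set0 integral_set0.
have -> : chart_map (atlas S m) @` (members hub `&` cell S m) = T @^-1` hill_disc n.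
  apply/seteqP; split=> [p [x [[cx H] _] <-] //|p pD].
  have cp := hill_cod pD; exists (chart_inv c p); last exact: chart_invK.
  have cx : chart_dom c (chart_inv c p) by exact: chart_inv_dom.
  by split; [split; rewrite ?chart_invK//|exact: index_m].
apply: integral_jac => // p pD; have cp := hill_cod pD.
have cx : chart_dom c (chart_inv c p) by exact: chart_inv_dom.
have cE : chart_at S (chart_inv c p) = c by rewrite /chart_at index_m.
apply/andP; split; first by rewrite mulr_ge0// sumr_ge0.
rewrite mulr_fsuml.
have PB k : `|poisson_bracket w (functions k) (functions hub) (chart_inv c p)| *
    `|w (chart_inv c p) (1, 0) (0, 1)| =
    `|jac (functions k \o chart_inv c) (functions hub \o chart_inv c) p|.
  by rewrite poisson_bracket_jac cE chart_invK//; exact: functions_diff.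
rewrite (eq_fsbigr (fun k => `|jac (functions k \o chart_inv c)
  (functions hub \o chart_inv c) p|)); last by move=> k _; exact: PB.
rewrite (fsbigE [seq inl (Some i) | i <- enum 'I_n.+1]) //=.
- under eq_bigl do rewrite in_setT.
  rewrite big_map big_enum/=; apply: ler_sum => i _; exact: jac_functions.
- by rewrite map_inj_uniq ?enum_uniq// => i j [].
- move=> [[i|]|j] _.
  + by move=> /negP[]; apply/mapP; exists i => //; rewrite mem_enum.
  + by move=> _; rewrite jac_self normr0.
  + by move=> _; rewrite jac_far// normr0.
Qed.

End Construction.

(** * The theorem *)

Theorem proposition1p7p3 (R : realType) (M : topologicalType)
    (S : smooth_surface R M) (w : area_form S) (eps : R) (eps_gt0 : 0 < eps) :
  exists (I : choiceType) (U : I -> set M) (i1 : I) (f : I -> M -> R),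
    [/\ disc_cover S U, confined U (U i1), essential U i1,
        positive_collection S f & subordinate f U] /\
    (integral_form w (U i1)
       (fun x => \sum_(i \in [set: I]) `|poisson_bracket w (f i) (f i1) x|)%R
     <= (1 + eps)%:E)%E.
Proof.
have eV : 0 < eps^-1 by rewrite invr_gt0.
pose n := Num.bound eps^-1.
have nE : eps^-1 < n%:R by apply: archi_boundP; exact: ltW.
have nR : 0 < n%:R :> R by exact: lt_trans nE.
have n0 : (0 < n)%N by rewrite -(ltr0n R).
have [m [[x xm] index_m]] := first_chart S.
pose c := atlas S m; pose p0 := chart_map c x.
have := open_nbhs_nbhs (conj (@chart_cod_open _ _ c) (chart_map_cod xm)).
move=> /plane_nbhsP[r r0 Hr].
have [B B0 [B1 B2]] := model_bounded R n.
(* At this scale all the planar domains of the model fit in the chart. *)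
pose e := r / B; have e0 : 0 < e by rewrite divr_gt0.
pose T := rescale p0 e.
have Tcod p : `|(T p).1| < B /\ `|(T p).2| < B -> chart_cod c p.
  have eE : B * e = r by rewrite /e mulrC divfK// gt_eqF.
  rewrite /T /rescale/= !normrM normfV (gtr0_norm e0) !ltr_pdivrMr// eE.
  by move=> [? ?]; exact: Hr.
have rect_cod : T @^-1` rect 5 (3 * n%:R + 1 + 4) `<=` chart_cod c.
  by move=> p /B1; exact: Tcod.
have shore_cod i : (i <= n)%N -> T @^-1` shore_disc n i `<=` chart_cod c.
  by move=> ni p /(B2 _ _ ni); exact: Tcod.
pose K := chart_preim c (T @^-1` rect 3 (3 * n%:R + 1 + 2)).
pose W := chart_preim c (T @^-1` rect 4 (3 * n%:R + 1 + 3)).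
pose W' := chart_preim c (T @^-1` graph_region (- 4) 0 4 (3 * n%:R + 1 + 3) 0).
have cK : closed K.
  apply: closed_chart_preim; first exact: surface_hausdorff S.
    by move=> p [p1 p2 p3 p4]; apply: rect_cod; split; lra.
  by apply: compact_rescale; [rewrite gt_eqF|exact: compact_rect].
have oW : open W'.
  apply: open_chart_preim.
  have H : planar_disc (@graph_region R (- 4) 0 4 (3 * n%:R + 1 + 3) 0).
    by apply: graph_region_disc => //; lra.
  by have [] := planar_disc_rescale p0 (lt0r_neq0 e0) H.
have KW : K `<=` W'.
  move=> y [cy [y1 y2 y3 y4]]; split => //.
  by split; rewrite ?mul0r ?subr0 ?add0r; lra.
have W'W : W' `<=` W.
  move=> y [cy []]; rewrite !mul0r !subr0 !add0r => y1 y2 y3 y4.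
  by split => //; split; exact: ltW.
have [A [V [g [gP glf gge]]]] := far_cover S cK oW KW.
have gge1 y : ~ W y -> exists2 j, A j & 1 <= g j y by move=> Wy; apply: gge => /W'W.
exists (option 'I_n.+1 + set_type A)%type, (@members R M S n m p0 e A V).
exists (inl None), (@functions R M S n m p0 e A g).
split.
  split.
  - exact: (members_disc_cover n0 e0 rect_cod shore_cod gP glf gge1).
  - exact: (hub_confined e0 rect_cod gP).
  - exact: (hub_essential e0 rect_cod gP).
  - exact: (functions_positive n0 e0 rect_cod shore_cod gP glf gge1).
  - exact: (functions_subordinate e0 rect_cod shore_cod gP).
apply: le_trans (hub_integral w n0 e0 index_m rect_cod shore_cod gP) _.
rewrite lee_fin -natr1 mulrDl mul1r divff ?gt_eqF// lerD2l.
by rewrite -[eps]invrK lef_pV2 ?posrE// ltW.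
Qed.
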